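(* Let $R$ be a commutative Noetherian ring with non-zero identity, $\mathfrak a$ an ideal of $R$, $\mathcal S$ a Serre subcategory of the category of $R$-modules, $(\mathcal T,\bigstar,\preceq)$ a partially ordered Abelian monoid and $\lambda:\mathcal S\to\mathcal T$ a subadditive function. Let $M$ be a finitely generated $R$-module, $X$ an arbitrary $R$-module, and $n$ a non-negative integer such that $\operatorname{Ext}^{n-r}_R(M,H^r_{\mathfrak a}(X))$ is in $\mathcal S$ for all $r$ with $0\le r\le n$. Then $H^n_{\mathfrak a}(M,X)\in\mathcal S$, and $$\lambda(H^n_{\mathfrak a}(M,X))\preceq \mathop{\bigstar}_{r=0}^{n}\lambda\big(\operatorname{Ext}^{n-r}_R(M,H^r_{\mathfrak a}(X))\big).$$
   Context: $H^i_{\mathfrak a}(M,X)=\varinjlim_{k}\operatorname{Ext}^i_R(M/\mathfrak a^kM,X)$ is the $i$-th generalized local cohomology module, and $H^i_{\mathfrak a}(X)=H^i_{\mathfrak a}(R,X)$ is ordinary local cohomology. A Serre subcategory $\mathcal S$ of the category of $R$-modules is a (nonempty) class of $R$-modules such that for every short exact sequence $0\to X'\to X\to X''\to 0$, $X\in\mathcal S$ if and only if $X',X''\in\mathcal S$. A partially ordered Abelian monoid is a commutative monoid $(\mathcal T,\bigstar)$ with identity element denoted $0$ and a partial order $\preceq$ compatible with $\bigstar$. A function $\lambda:\mathcal S\to\mathcal T$ is subadditive if $\lambda(0)=0$ and for every short exact sequence $0\to X'\to X\to X''\to 0$ with all terms in $\mathcal S$: $\lambda(X')\preceq\lambda(X)$,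 $\lambda(X'')\preceq\lambda(X)$ and $\lambda(X)\preceq\lambda(X')\bigstar\lambda(X'')$. *)

(* Defs.v *)
From HB Require Import structures.
From mathcomp Require Import all_boot all_order all_algebra.
From mathcomp Require Import boolp classical_sets functions.
From mathcomp Require Import freeg.

Set Implicit Arguments.
Unset Strict Implicit.
Unset Printing Implicit Defensive.

Import Order.TTheory GRing.Theory Num.Theory.
Local Open Scope ring_scope.
Local Open Scope quotient_scope.

Section GeneralizedLocalCohomology.
Variable R : comNzRingType.

Record submodule (V : lmodType R) := Submodule {
  carrier :> V -> Prop;
  submodule0 : carrier 0;
  submoduleD : forall x y, carrier x -> carrier y -> carrier (x + y);
  submoduleZ : forall (c : R) x, carrier x -> carrier (c *: x) }.

Definition smem (V : lmodType R) (W : submodule V) : {pred V} :=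
  fun x => `[< W x >].

Lemma smemP (V : lmodType R) (W : submodule V) x : reflect (W x) (x \in smem W).
Proof. exact: asboolP. Qed.

Fact smem_closed (V : lmodType R) (W : submodule V) : submod_closed (smem W).
Proof.
split; first by apply/smemP; exact: submodule0.
move=> c x y /smemP Wx /smemP Wy; apply/smemP.
by apply: submoduleD => //; exact: submoduleZ.
Qed.

HB.instance Definition _ (V : lmodType R) (W : submodule V) :=
  GRing.isSubmodClosed.Build R V (smem W) (smem_closed W).

Record submod (V : lmodType R) (W : submodule V) :=
  Submod { submod_val :> V; submod_mem : submod_val \in smem W }.

HB.instance Definition _ (V : lmodType R) (W : submodule V) :=
  [isSub for @submod_val V W].
HB.instance Definition _ (V : lmodType R) (W : submodule V) :=
  [Choice of submod W by <:].
HB.instance Definition _ (V : lmodType R) (W : submodule V) :=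
  [SubChoice_isSubLmodule of submod W by <:].

Definition quotmod (V : lmodType R) (W : submodule V) := Quotient.quot (smem W).

HB.instance Definition _ (V : lmodType R) (W : submodule V) :=
  GRing.Zmodule.on (quotmod W).

Section QuotScale.
Variables (V : lmodType R) (W : submodule V).

Definition qpi (x : V) : quotmod W := \pi_(Quotient.quot (smem W)) x.

Lemma qpi_eq x y : qpi x = qpi y <-> W (x - y).
Proof.
split=> [/eqP|Wxy].
  by rewrite -[_ == _]Quotient.idealrBE => /smemP.
by apply/eqP; rewrite -[_ == _]Quotient.idealrBE; apply/smemP.
Qed.

Lemma qpi_surj (q : quotmod W) : exists x, qpi x = q.
Proof. by exists (repr q); rewrite /qpi reprK. Qed.

Fact qpi_zmod : zmod_morphism qpi.
Proof. by move=> x y; rewrite /qpi raddfB. Qed.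

HB.instance Definition _ := GRing.isZmodMorphism.Build V (quotmod W) qpi qpi_zmod.

Definition qscale (c : R) (q : quotmod W) : quotmod W := qpi (c *: repr q).

Lemma qpiZ c x : qscale c (qpi x) = qpi (c *: x).
Proof.
rewrite /qscale; apply/qpi_eq; rewrite -scalerBr; apply: submoduleZ.
by apply/qpi_eq; rewrite {1}/qpi reprK.
Qed.

Fact qscaleA c d q : qscale c (qscale d q) = qscale (c * d) q.
Proof. by have [x <-] := qpi_surj q; rewrite !qpiZ scalerA. Qed.

Fact qscale1 : left_id 1 qscale.
Proof. by move=> q; have [x <-] := qpi_surj q; rewrite qpiZ scale1r. Qed.

Fact qscaleDr : right_distributive qscale +%R.
Proof.
move=> c p q; have [x <-] := qpi_surj p; have [y <-] := qpi_surj q.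
by rewrite -raddfD !qpiZ scalerDr raddfD.
Qed.

Fact qscaleDl q : {morph qscale^~ q : c d / c + d}.
Proof. by move=> c d; have [x <-] := qpi_surj q; rewrite !qpiZ scalerDl raddfD. Qed.

HB.instance Definition _ :=
  GRing.Zmodule_isLmodule.Build R (quotmod W) qscaleA qscale1 qscaleDr qscaleDl.

Fact qpi_scalable : scalable qpi.
Proof. by move=> c x; rewrite -qpiZ. Qed.

HB.instance Definition _ :=
  GRing.isScalable.Build R V (quotmod W) *:%R qpi qpi_scalable.

End QuotScale.

Section Kernel.
Variables (U V : lmodType R) (f : {linear U -> V}).

Fact ker0 : f 0 = 0. Proof. exact: linear0. Qed.
Fact kerD x y : f x = 0 -> f y = 0 -> f (x + y) = 0.
Proof. by move=> fx fy; rewrite linearD fx fy addr0. Qed.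
Fact kerZ (c : R) x : f x = 0 -> f (c *: x) = 0.
Proof. by move=> fx; rewrite linearZ_LR fx scaler0. Qed.
Definition kernel : submodule U := @Submodule U (fun x => f x = 0) ker0 kerD kerZ.

Fact img0 : exists x, f x = 0. Proof. by exists 0; rewrite linear0. Qed.
Fact imgD y z : (exists x, f x = y) -> (exists x, f x = z) ->
  exists x, f x = y + z.
Proof. by move=> [x <-] [x' <-]; exists (x + x'); rewrite linearD. Qed.
Fact imgZ (c : R) y : (exists x, f x = y) -> exists x, f x = c *: y.
Proof. by move=> [x <-]; exists (c *: x); rewrite linearZ_LR. Qed.
Definition image_sub : submodule V :=
  @Submodule V (fun y => exists x, f x = y) img0 imgD imgZ.

Definition preimage_sub (W : submodule V) : submodule U.
Proof.
apply: (@Submodule U (fun x => W (f x))) => /=.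
- by rewrite linear0; exact: submodule0.
- by move=> x y Wx Wy; rewrite linearD; exact: submoduleD.
- by move=> c x Wx; rewrite linearZ_LR; exact: submoduleZ.
Defined.

End Kernel.

Definition full_sub (V : lmodType R) : submodule V :=
  @Submodule V (fun=> True) I (fun _ _ _ _ => I) (fun _ _ _ => I).

Definition incl (V : lmodType R) (Z : submodule V) : {linear submod Z -> V} :=
  \val.

(* Z / (B `&` Z): the inclusion of B in Z is not required. *)
Definition subquot (V : lmodType R) (Z B : submodule V) : lmodType R :=
  quotmod (preimage_sub (incl Z) B).

Section InducedMaps.
Variables (V V' : lmodType R) (f : {linear V -> V'}).
Implicit Types (W Z B : submodule V).

Definition submod_map Z (Z' : submodule V') (fZ : forall x, Z x -> Z' (f x)) (z : submod Z) :
    submod Z' :=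
  @Submod V' Z' (f (\val z)) (introT (smemP Z' _) (fZ _ (elimT (smemP Z _) (submod_mem z)))).

Fact submod_map_linear Z (Z' : submodule V') (fZ : forall x, Z x -> Z' (f x)) :
  linear (submod_map fZ).
Proof. by move=> c x y; apply: val_inj; rewrite /= !linearP. Qed.

HB.instance Definition _ Z (Z' : submodule V') (fZ : forall x, Z x -> Z' (f x)) :=
  GRing.isLinear.Build R (submod Z) (submod Z') *:%R (submod_map fZ)
    (submod_map_linear fZ).

Definition quotmod_map W (W' : submodule V') (fW : forall x, W x -> W' (f x)) (q : quotmod W) :
  quotmod W' := qpi W' (f (repr q)).

Lemma quotmod_mapE W (W' : submodule V') (fW : forall x, W x -> W' (f x)) x :
  quotmod_map fW (qpi W x) = qpi W' (f x).
Proof.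
apply/qpi_eq; rewrite -linearB; apply: fW.
by apply/qpi_eq; rewrite {1}/qpi reprK.
Qed.

Fact quotmod_map_linear W (W' : submodule V') (fW : forall x, W x -> W' (f x)) :
  linear (quotmod_map fW).
Proof.
move=> c p q; have [x <-] := qpi_surj p; have [y <-] := qpi_surj q.
by rewrite -linearP !quotmod_mapE -linearP -linearP.
Qed.

HB.instance Definition _ W (W' : submodule V') (fW : forall x, W x -> W' (f x)) :=
  GRing.isLinear.Build R (quotmod W) (quotmod W') *:%R (quotmod_map fW)
    (quotmod_map_linear fW).

End InducedMaps.

Definition subquot_map (V V' : lmodType R) (f : {linear V -> V'})
    (Z B : submodule V) (Z' B' : submodule V')
    (fZ : forall x, Z x -> Z' (f x)) (fB : forall x, B x -> B' (f x)) :
    {linear subquot Z B -> subquot Z' B'} :=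
  @quotmod_map _ _ (submod_map fZ) (preimage_sub (incl Z) B)
    (preimage_sub (incl Z') B')
    (fun z => fB (\val z)).

Section Product.
Variable V : nat -> lmodType R.

Definition prodmod := forall k, V k.

HB.instance Definition _ := gen_eqMixin prodmod.
HB.instance Definition _ := gen_choiceMixin prodmod.

Let padd (x y : prodmod) : prodmod := fun k => x k + y k.
Let popp (x : prodmod) : prodmod := fun k => - x k.
Let pzero : prodmod := fun=> 0.
Let pscale (c : R) (x : prodmod) : prodmod := fun k => c *: x k.

Fact paddA : associative padd.
Proof. by move=> x y z; apply: functional_extensionality_dep => k; exact: addrA. Qed.
Fact paddC : commutative padd.
Proof. by move=> x y; apply: functional_extensionality_dep => k; exact: addrC. Qed.
Fact padd0 : left_id pzero padd.
Proof. by move=> x; apply: functional_extensionality_dep => k; exact: add0r. Qed.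
Fact paddN : left_inverse pzero popp padd.
Proof. by move=> x; apply: functional_extensionality_dep => k; exact: addNr. Qed.

HB.instance Definition _ :=
  GRing.isZmodule.Build prodmod paddA paddC padd0 paddN.

Fact pscaleA c d x : pscale c (pscale d x) = pscale (c * d) x.
Proof. by apply: functional_extensionality_dep => k; exact: scalerA. Qed.
Fact pscale1 : left_id 1 pscale.
Proof. by move=> x; apply: functional_extensionality_dep => k; exact: scale1r. Qed.
Fact pscaleDr : right_distributive pscale +%R.
Proof. by move=> c x y; apply: functional_extensionality_dep => k; exact: scalerDr. Qed.
Fact pscaleDl x : {morph pscale^~ x : c d / c + d}.
Proof. by move=> c d; apply: functional_extensionality_dep => k; exact: scalerDl. Qed.

HB.instance Definition _ :=
  GRing.Zmodule_isLmodule.Build R prodmod pscaleA pscale1 pscaleDr pscaleDl.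

End Product.

Section DirectLimit.
Variables (V : nat -> lmodType R) (f : forall k, {linear V k -> V k.+1}).
Local Open Scope nat_scope.

Definition eventually_compatible : submodule (prodmod V).
Proof.
apply: (@Submodule (prodmod V)
  (fun x => exists N, forall k, N <= k -> f k (x k) = x k.+1)).
- by exists 0 => k _; rewrite linear0.
- move=> x y [N xN] [N' yN]; exists (maxn N N') => k.
  by rewrite geq_max => /andP[/xN xk /yN yk]; rewrite linearD xk yk.
- by move=> c x [N xN]; exists N => k /xN xk; rewrite linearZ_LR xk.
Defined.

Definition eventually_zero : submodule (prodmod V).
Proof.
apply: (@Submodule (prodmod V) (fun x => exists N, forall k, N <= k -> x k = 0%R)).
- by exists 0.
- move=> x y [N xN] [N' yN]; exists (maxn N N') => k.
  rewrite geq_max => /andP[/xN xk /yN yk].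
  by rewrite -[LHS]/(x k + y k)%R xk yk addr0.
- by move=> c x [N xN]; exists N => k /xN xk; rewrite -[LHS]/(c *: x k)%R xk scaler0.
Defined.

(* The direct limit of V 0 -> V 1 -> V 2 -> ... is realized as the module of  *)
(* eventually compatible sequences modulo the eventually zero ones; the       *)
(* element of the limit given by x : V j is the class of the sequence         *)
(* push j x = (0, .., 0, x, f x, f (f x), ..).  The lemmas dlim_in_step,      *)
(* dlim_in_surj and dlim_in_eq0 below identify it with the usual colimit.     *)
Definition dlim : lmodType R := subquot eventually_compatible eventually_zero.

Fixpoint push j (x : V j) k : V k :=
  match j =P k with
  | ReflectT e => ecast i (V i) e x
  | ReflectF _ => if k is k'.+1 return V k then f k' (push x k') else 0%R
  end.

Lemma push_id j (x : V j) : push x j = x.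
Proof.
by case: j x => [|j] x /=; case: eqP => // e; rewrite (eq_axiomK e).
Qed.

Lemma push_step j (x : V j) k : j <= k -> f k (push x k) = push x k.+1.
Proof. by move=> jk /=; case: eqP => // e; exfalso; move: jk; rewrite e ltnn. Qed.

Lemma push_lt j (x : V j) k : k < j -> push x k = 0%R.
Proof.
elim: k => [|k IH] kj /=; case: eqP => // e; first by exfalso; move: kj; rewrite e.
  by exfalso; move: kj; rewrite -e ltnn.
by rewrite IH ?linear0 // ltnW.
Qed.

Fact push_compatible j (x : V j) :
  (push x : prodmod V) \in smem eventually_compatible.
Proof. by apply/smemP; exists j => k; exact: push_step. Qed.

Definition dlim_in j (x : V j) : dlim := qpi _ (Submod (push_compatible x)).

Lemma eq_push j (x : V j) (y : prodmod V) :
  y j = x -> (forall k, j <= k -> f k (y k) = y k.+1) ->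
  forall k, j <= k -> y k = push x k.
Proof.
move=> yj yS; elim=> [|k IH].
  by rewrite leqn0 => /eqP j0; subst j; rewrite push_id.
rewrite leq_eqVlt => /orP[/eqP ek|]; first by subst j; rewrite push_id.
by rewrite ltnS => jk; rewrite -yS // IH // push_step.
Qed.

Lemma dlim_in_step k (x : V k) : dlim_in (f k x) = dlim_in x.
Proof.
apply/qpi_eq; exists k.+1 => m km.
rewrite -[LHS]/(push (f k x) m - push x m)%R; apply/eqP.
rewrite subr_eq0 eq_sym; apply/eqP; apply: eq_push km => //.
  by rewrite -push_step // push_id.
by move=> i /ltnW; exact: push_step.
Qed.

Lemma dlim_in_surj (q : dlim) : exists k (x : V k), dlim_in x = q.
Proof.
have [[y ym] <-] := qpi_surj q; have /smemP[N yN] := ym.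
exists N, (y N); apply/qpi_eq; exists N => k Nk.
rewrite -[LHS]/(push (y N) k - y k)%R; apply/eqP; rewrite subr_eq0 eq_sym.
by apply/eqP; exact: eq_push.
Qed.

Lemma dlim_in_eq0 k (x : V k) :
  dlim_in x = 0%R <-> exists2 m, k <= m & push x m = 0%R.
Proof.
rewrite -[0%R in X in X <-> _](linear0 (qpi _)); split.
  move/qpi_eq; rewrite subr0 => -[N xN]; exists (maxn k N); first exact: leq_maxl.
  by apply: xN; exact: leq_maxr.
move=> [m km xm]; apply/qpi_eq; rewrite subr0; exists m.
elim=> [|i IH]; first by rewrite leqn0 => /eqP <-.
rewrite leq_eqVlt => /orP[/eqP <- //|]; rewrite ltnS => mi.
by rewrite -[LHS]/(push x i.+1) -push_step ?(leq_trans km) // [push x i]IH ?linear0.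
Qed.

End DirectLimit.

Section Hom.
Variables (M X : lmodType R).

Definition linear_maps : submodule (M -> X).
Proof.
apply: (@Submodule (M -> X) (fun h : M -> X => linear h)).
- by move=> c x y /=; rewrite scaler0 addr0.
- move=> g h lg lh c x y; rewrite -[LHS]/(g (c *: x + y) + h (c *: x + y)).
  by rewrite lg lh addrACA -scalerDr.
- move=> d h lh c x y; rewrite -[LHS]/(d *: h (c *: x + y)) lh.
  by rewrite scalerDr !scalerA mulrC -scalerA.
Defined.

Definition Hom : lmodType R := submod linear_maps.

End Hom.

Section Precomposition.
Variables (M N X : lmodType R) (u : {linear M -> N}).

Definition precomp (h : N -> X) : M -> X := h \o u.

Fact precomp_linear : linear precomp. Proof. by []. Qed.
HB.instance Definition _ :=
  GRing.isLinear.Build R (N -> X) (M -> X) *:%R precomp precomp_linear.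

Fact precomp_hom (h : N -> X) : linear_maps N X h -> linear_maps M X (precomp h).
Proof. by move=> lh c x y; rewrite /precomp /= linearP lh. Qed.

Definition Hom_map : {linear Hom N X -> Hom M X} := submod_map precomp_hom.

End Precomposition.

Section FreeModule.
Variables (K : choiceType) (M : lmodType R) (h : K -> M).

HB.instance Definition _ :=
  GRing.isZmodMorphism.Build {freeg K / R} M (fglift h) (lift_is_additive h).

Fact fglift_scalable : scalable (fglift h : {freeg K / R} -> M).
Proof.
move=> c D; rewrite -[c *: D]/(fgscale c D) /fgscale.
rewrite -[in RHS](freeg_sumE D) !raddf_sum /=.
by apply: eq_bigr => x _; rewrite !liftU scalerA.
Qed.

HB.instance Definition _ :=
  GRing.isScalable.Build R {freeg K / R} M *:%R (fglift h) fglift_scalable.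

End FreeModule.

(* The free module on the underlying set of M, with its augmentation onto M   *)
(* and the kernel of the latter.                                              *)
Definition freemod (M : lmodType R) : lmodType R := {freeg M / R}.
Definition aug (M : lmodType R) : {linear freemod M -> M} := fglift (@id M).
Definition syz (M : lmodType R) : lmodType R := submod (kernel (aug M)).

Fixpoint syzn n (M : lmodType R) : lmodType R :=
  if n is n'.+1 then syz (syzn n' M) else M.

(* The standard free resolution ... -> res 1 M -> res 0 M -> M -> 0, which is *)
(* functorial in M.                                                           *)
Definition res n (M : lmodType R) : lmodType R := freemod (syzn n M).
Definition bd n (M : lmodType R) : {linear res n.+1 M -> res n M} :=
  incl _ \o aug (syzn n.+1 M).

Lemma augU (M : lmodType R) (x : M) : aug M << x >> = x.
Proof. by rewrite /= liftU scale1r. Qed.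

Lemma res_exact0 (M : lmodType R) (x : res 0 M) :
  aug M x = 0 <-> exists y, bd 0 M y = x.
Proof.
split=> [/(introT (smemP (kernel (aug M)) x)) xK|[y <-]].
  by exists << (Submod xK : syz M) >>; rewrite /bd /= liftU scale1r.
by apply/(smemP (kernel (aug M))); exact: submod_mem.
Qed.

Lemma res_exact n (M : lmodType R) (x : res n.+1 M) :
  bd n M x = 0 <-> exists y, bd n.+1 M y = x.
Proof.
rewrite -(res_exact0 (M := syzn n.+1 M)); split=> [bx|]; last first.
  by rewrite /bd /= => ->.
exact: val_inj.
Qed.

Section Functoriality.
Variables (M N : lmodType R) (u : {linear M -> N}).

Definition freemod_map : {linear freemod M -> freemod N} :=
  fglift (fun x => << u x >> : freemod N).

Lemma aug_natural x : aug N (freemod_map x) = u (aug M x).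
Proof.
rewrite -(freeg_sumE x) !linear_sum; apply: eq_bigr => y _ /=.
by rewrite !liftU linearZ_LR /= liftU scale1r linearZ_LR.
Qed.

Fact freemod_map_ker x : kernel (aug M) x -> kernel (aug N) (freemod_map x).
Proof. by rewrite /kernel /= => x0; have := aug_natural x; rewrite /= x0 linear0. Qed.

Definition syz_map : {linear syz M -> syz N} := submod_map freemod_map_ker.

End Functoriality.

Fixpoint syzn_map (M N : lmodType R) (u : {linear M -> N}) n :
    {linear syzn n M -> syzn n N} :=
  if n is n'.+1 return {linear syzn n M -> syzn n N}
  then syz_map (syzn_map u n') else u.

Definition res_map (M N : lmodType R) (u : {linear M -> N}) n :
  {linear res n M -> res n N} := freemod_map (syzn_map u n).

Lemma bd_natural (M N : lmodType R) (u : {linear M -> N}) n x :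
  bd n N (res_map u n.+1 x) = res_map u n (bd n M x).
Proof. by have /(congr1 val) := aug_natural (syzn_map u n.+1) x. Qed.

(* Ext^n_R(M, X) is the n-th cohomology of the complex Hom_R(res _ M, X).     *)
Definition cobd n (M X : lmodType R) : {linear Hom (res n M) X -> Hom (res n.+1 M) X} :=
  Hom_map X (bd n M).

Definition zero_sub (V : lmodType R) : submodule V := 
  kernel (idfun : {linear V -> V}).

Definition cocycles n (M X : lmodType R) : submodule (Hom (res n M) X) :=
  kernel (cobd n M X).
Definition coboundaries n (M X : lmodType R) : submodule (Hom (res n M) X) :=
  if n is n'.+1 return submodule (Hom (res n M) X)
  then image_sub (cobd n' M X) else zero_sub _.

Definition Ext n (M X : lmodType R) : lmodType R :=
  subquot (cocycles n M X) (coboundaries n M X).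

Section ExtMap.
Variables (M N X : lmodType R) (u : {linear M -> N}).

Definition cochain_map n : {linear Hom (res n N) X -> Hom (res n M) X} :=
  Hom_map X (res_map u n).

Lemma cochain_natural n (h : Hom (res n N) X) :
  cochain_map n.+1 (cobd n N X h) = cobd n M X (cochain_map n h).
Proof.
apply: val_inj; apply: functional_extensionality_dep => x.
exact: (congr1 (submod_val h) (bd_natural u x)).
Qed.

Fact cochain_cocycles n h : cocycles n N X h -> cocycles n M X (cochain_map n h).
Proof.
by rewrite /cocycles /kernel /= => dh; have := cochain_natural h; rewrite /= dh linear0.
Qed.

Fact cochain_coboundaries n h :
  coboundaries n N X h -> coboundaries n M X (cochain_map n h).
Proof.
case: n h => [|n] h /=; first by move=> ->; rewrite linear0.
by move=> [g <-]; exists (cochain_map n g); rewrite cochain_natural.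
Qed.

Definition Ext_map n : {linear Ext n N X -> Ext n M X} :=
  subquot_map (@cochain_cocycles n) (@cochain_coboundaries n).

End ExtMap.

Notation ideal := (submodule R^o).

Section IdealProduct.
Variables (I : ideal) (V : lmodType R) (N : submodule V).

Definition in_prod (v : V) : Prop := exists2 s : seq (R * V),
  (forall p, p \in s -> I p.1 /\ N p.2) & v = \sum_(p <- s) p.1 *: p.2.

Fact in_prod0 : in_prod 0.
Proof. by exists [::]; rewrite ?big_nil. Qed.
Fact in_prodD v w : in_prod v -> in_prod w -> in_prod (v + w).
Proof.
move=> [s sIN ->] [t tIN ->]; exists (s ++ t); last by rewrite big_cat.
by move=> p; rewrite mem_cat => /orP[/sIN|/tIN].
Qed.
Fact in_prodZ (c : R) v : in_prod v -> in_prod (c *: v).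
Proof.
move=> [s sIN ->]; exists [seq (c * p.1, p.2) | p <- s].
  by move=> _ /mapP[p /sIN[Ip Np] ->]; split=> //; exact: (submoduleZ c Ip).
by rewrite big_map scaler_sumr; apply: eq_bigr => p _; rewrite scalerA.
Qed.

Definition ideal_mul : submodule V := Submodule in_prod0 in_prodD in_prodZ.

End IdealProduct.

Fixpoint ideal_pow (I : ideal) k : ideal :=
  if k is k'.+1 then ideal_mul I (ideal_pow I k') else full_sub R^o.

Section LocalCohomology.
Variable a : ideal.

Fact ideal_powS k x : ideal_pow a k.+1 x -> ideal_pow a k x.
Proof.
move=> [s sP ->]; elim: s sP => [|p s IH] sP.
  by rewrite big_nil; exact: submodule0.
rewrite big_cons; apply: submoduleD.
  by apply: submoduleZ; case: (sP p (mem_head _ _)).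
by apply: IH => q qs; apply: sP; rewrite inE qs orbT.
Qed.

Definition trunc (M : lmodType R) k : lmodType R :=
  quotmod (ideal_mul (ideal_pow a k) (full_sub M)).

Fact trunc_sub (M : lmodType R) k (x : M) :
  ideal_mul (ideal_pow a k.+1) (full_sub M) x ->
  ideal_mul (ideal_pow a k) (full_sub M) (idfun x).
Proof. by move=> [s sP ->]; exists s => // p /sP[/ideal_powS]. Qed.

Definition trunc_map (M : lmodType R) k : {linear trunc M k.+1 -> trunc M k} :=
  @quotmod_map M M idfun _ _ (@trunc_sub M k).

Definition gen_local_cohomology i (M X : lmodType R) : lmodType R :=
  dlim (fun k => Ext_map X (trunc_map M k) i).

Definition local_cohomology i (X : lmodType R) : lmodType R :=
  gen_local_cohomology i R^o X.

End LocalCohomology.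

End GeneralizedLocalCohomology.

Notation ideal R := (submodule (R^o : lmodType R)).

Definition finitely_generated (R : comNzRingType) (V : lmodType R) : Prop :=
  exists (n : nat) (e : 'I_n -> V),
    forall v, exists c : 'I_n -> R, v = \sum_(i < n) c i *: e i.

Definition noetherian (R : comNzRingType) : Prop :=
  forall I : ideal R, finitely_generated (submod I).

Definition short_exact (R : comNzRingType) (X' X X'' : lmodType R)
    (f : {linear X' -> X}) (g : {linear X -> X''}) : Prop :=
  [/\ injective f, (forall y, exists x, g x = y)
    & forall x, g x = 0 <-> exists x', f x' = x].

Definition serre (R : comNzRingType) (S : lmodType R -> Prop) : Prop :=
  (exists X, S X) /\
  forall (X' X X'' : lmodType R) (f : {linear X' -> X}) (g : {linear X -> X''}),
    short_exact f g -> (S X <-> S X' /\ S X'').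

Record po_monoid (T : nmodType) (le : T -> T -> Prop) : Prop := PoMonoid {
  po_refl : forall x, le x x;
  po_trans : forall x y z, le x y -> le y z -> le x z;
  po_anti : forall x y, le x y -> le y x -> x = y;
  po_add : forall x y z, le x y -> le (x + z) (y + z) }.

(* A function S -> T is represented by a total function on modules of which   *)
(* only the values on S are constrained (zero modules lie in every Serre      *)
(* subcategory).                                                              *)
Definition subadditive (R : comNzRingType) (S : lmodType R -> Prop)
    (T : nmodType) (le : T -> T -> Prop) (lam : lmodType R -> T) : Prop :=
  (forall Z : lmodType R, (forall z : Z, z = 0) -> lam Z = 0) /\
  forall (X' X X'' : lmodType R) (f : {linear X' -> X}) (g : {linear X -> X''}),
    short_exact f g -> S X' -> S X -> S X'' ->
    [/\ le (lam X') (lam X), le (lam X'') (lam X)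
      & le (lam X) (lam X' + lam X'')].

(* Main.v *)
Require Import Defs.
From HB Require Import structures.
From mathcomp Require Import all_boot all_order all_algebra.
From mathcomp Require Import boolp freeg.
Set Implicit Arguments.
Unset Strict Implicit.
Unset Printing Implicit Defensive.
Import Order.TTheory GRing.Theory Num.Theory.
Local Open Scope ring_scope.

(** Write H^n(M) for the generalized local cohomology of M in X and Y_r for the
    ordinary local cohomology of X in degree r.  The statement is what the
    spectral sequence Ext^p(M, Y_q) => H^(p+q)(M) would give; the filtration of
    H^n(M) is obtained here by induction on n, from long exact sequences in the
    variable M.

    The action of H^n on the maps R -> M, r |-> r m, is an edge map from H^n(M)
    to Hom(M, Y_n) = Ext^0(M, Y_n).  It is natural in M, and bijective when M is
    free of finite rank because H^n is additive ([edge_free_inj],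
    [edge_free_surj]).  So H^n(M) is an extension of a submodule of
    Ext^0(M, Y_n) by the kernel of the edge map, and it remains to see that this
    kernel is filtered by subquotients of Ext^(n-r)(M, Y_r) for r < n.

    Take an exact sequence 0 -> K -> P -> M -> 0 with P free of finite rank; K is
    finitely generated.  There are exact sequences
      H^n(P) -> H^n(K) -> H^(n+1)(M) -> H^(n+1)(P)
      Ext^i(P, Y) -> Ext^i(K, Y) -> Ext^(i+1)(M, Y)
    ([glc_connecting], [Ext_connecting]).  The kernel of the edge map of M in
    degree n+1 dies in H^(n+1)(P), hence comes from H^n(K).  Sending the image of
    x in H^n(K) to the image in Ext^1(M, Y_n) of the edge of x is well defined,
    and its kernel is a quotient of a submodule of the kernel of the edge map of
    K in degree n ([bounded_connecting]).  Since Ext^i(P, Y) = 0 for i > 0,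
    Ext^(n-r)(K, Y_r) embeds in Ext^(n+1-r)(M, Y_r) for r < n, so that the
    induction hypothesis for K is the bound needed for M
    ([edge_kernel_bounded]).

    The exact sequence for H^n is the direct limit of exact sequences of Ext for
    0 -> K/(K & a^k P) -> P/a^k P -> M/a^k M -> 0; a weak form of the Artin-Rees
    lemma ([artin_rees]) compares the filtrations K & a^k P and a^k K.  The exact
    sequence for Ext uses that the kernels of the maps between the standard
    resolutions of P and M form a projective resolution of K
    ([ker_resolution]), which is compared with the standard one. *)

(** * Linear maps and projective modules *)

Section LinearMaps.
Variable R : comNzRingType.
Implicit Types U V W : lmodType R.

Definition linear_pack U V (f : U -> V) (lf : linear f) : {linear U -> V} :=
  HB.pack f (GRing.isLinear.Build R U V *:%R f lf).

(** Connecting maps and maps between direct limits are defined through a choice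
    of representatives; it is easier to describe them as linear relations, which
    only at the end are recognized as graphs. *)
Lemma linear_of_relation U V (L : U -> V -> Prop) :
  (forall x, exists y, L x y) ->
  (forall (c : R) x y x' y', L x y -> L x' y' -> L (c *: x + x') (c *: y + y')) ->
  (forall y, L 0 y -> y = 0) ->
  exists f : {linear U -> V}, (forall x, L x (f x)) /\ forall x y, L x y -> f x = y.
Proof.
move=> Ltot Llin L0.
have Luniq x y y' : L x y -> L x y' -> y = y'.
  move=> Ly Ly'; apply/eqP; rewrite -subr_eq0; apply/eqP/L0.
  by have := Llin (-1) _ _ _ _ Ly' Ly; rewrite !scaleN1r addNr addrC.
have [f fP] := choice Ltot.
have lf : linear f by move=> c x y; apply: Luniq (fP _) (Llin _ _ _ _ _ (fP x) (fP y)).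
by exists (linear_pack lf); split=> // x y; exact: Luniq (fP x).
Qed.

Lemma linear_lift U V W (i : {linear V -> W}) (g : {linear U -> W}) :
  injective i -> (forall x, exists y, i y = g x) ->
  exists f : {linear U -> V}, forall x, i (f x) = g x.
Proof.
move=> inj_i im_g.
have [//|||f [fP _]] := @linear_of_relation U V (fun x y => i y = g x).
- by move=> c x y x' y' e e'; rewrite !linearP e e'.
- by move=> y; rewrite linear0 => e; apply: inj_i; rewrite e linear0.
by exists f.
Qed.

Lemma linear_factor U V W (p : {linear U -> V}) (g : {linear U -> W}) :
  (forall y, exists x, p x = y) -> (forall x, p x = 0 -> g x = 0) ->
  exists f : {linear V -> W}, forall x, f (p x) = g x.
Proof.
move=> surj_p ker_p.
have [|||f [fP _]] := @linear_of_relation V W (fun y z => exists2 x, p x = y & g x = z).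
- by move=> y; have [x <-] := surj_p y; exists (g x), x.
- move=> c _ _ _ _ [x <- <-] [x' <- <-].
  by exists (c *: x + x'); rewrite linearP.
- by move=> z [x /ker_p -> <-].
exists f => x; have [x' px' <-] := fP (p x); apply/eqP.
by rewrite -subr_eq0 -linearB; apply/eqP/ker_p; rewrite linearB px' subrr.
Qed.

(** Asking only that the image of f lie in that of g, instead of surjectivity of
    g, makes lifts along exact complexes immediate. *)
Definition projective (P : lmodType R) : Prop :=
  forall (U V : lmodType R) (g : {linear U -> V}) (f : {linear P -> V}),
    (forall x, exists y, g y = f x) ->
    exists h : {linear P -> U}, forall x, g (h x) = f x.

Lemma linear_freeg (K : choiceType) V (f g : {linear {freeg K / R} -> V}) :
  (forall k, f << k >> = g << k >>) -> f =1 g.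
Proof.
move=> fg x; rewrite -(freeg_sumE x) !linear_sum; apply: eq_bigr => k _.
have -> : << coeff k x *g k >> = coeff k x *: (<< k >> : {freeg K / R}).
  by apply/eqP/freeg_eqP => y; rewrite coeffZ !coeffU mul1r.
by rewrite !linearZ_LR fg.
Qed.

Lemma projective_freemod M : projective (freemod M).
Proof.
move=> U V g f im_g.
have [h hP] := choice (fun m : M => im_g << m >>).
exists (fglift h : {linear freemod M -> U}) => x.
apply: (linear_freeg (f := g \o (fglift h : {linear freemod M -> U}))) => m /=.
by rewrite liftU scale1r.
Qed.

Lemma projective_retract (P Q : lmodType R) (s : {linear P -> Q}) (r : {linear Q -> P}) :
  projective Q -> cancel s r -> projective P.
Proof.
move=> projQ sK U V g f im_g.
have [|h hP] := projQ _ _ g (f \o r); first by move=> x; exact: im_g.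
by exists (h \o s) => x; rewrite /= hP /= sK.
Qed.

Lemma projective_rV n : projective 'rV[R]_n.
Proof.
move=> U V g f im_g.
have [h hP] := choice (fun i : 'I_n => im_g (delta_mx 0 i)).
have lh : linear (fun x : 'rV[R]_n => \sum_i x 0 i *: h i).
  move=> c x y; rewrite scaler_sumr -big_split; apply: eq_bigr => i _ /=.
  by rewrite !mxE scalerDl scalerA.
exists (linear_pack lh) => x /=.
rewrite [in RHS](row_sum_delta x) !linear_sum; apply: eq_bigr => i _.
by rewrite !linearZ_LR hP.
Qed.

Record resolution (M : lmodType R) := Resolution {
  term : nat -> lmodType R;
  diff : forall n, {linear term n.+1 -> term n};
  augm : {linear term 0 -> M};
  term_projective : forall n, projective (term n);
  augm_surj : forall x, exists y, augm y = x;
  augm_exact : forall x, augm x = 0 <-> exists y, diff 0 y = x;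
  diff_exact : forall n x, diff n x = 0 <-> exists y, diff n.+1 y = x }.
End LinearMaps.

(** * Resolutions, comparison and homotopy *)

Section Comparison.
Variable R : comNzRingType.
Implicit Types L M N X : lmodType R.

Lemma diff_diff M (P : resolution M) n x : diff P n (diff P n.+1 x) = 0.
Proof. by apply/diff_exact; exists x. Qed.

Lemma augm_diff M (P : resolution M) x : augm P (diff P 0 x) = 0.
Proof. by apply/augm_exact; exists x. Qed.

Definition chain_map M N (P : resolution M) (Q : resolution N)
    (f : forall n, {linear term P n -> term Q n}) : Prop :=
  forall n x, diff Q n (f n.+1 x) = f n (diff P n x).

Definition coboundary M X (P : resolution M) n (h : term P n -> X) : Prop :=
  match n return (term P n -> X) -> Prop with
  | 0 => fun h => forall x, h x = 0
  | m.+1 => fun h => exists g : {linear term P m -> X}, forall x, h x = g (diff P m x)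
  end h.

(** A partial lift can be continued as soon as its last component carries
    boundaries to boundaries, so this is the invariant of the recursion. *)
Lemma comparison_lift M N (P : resolution M) (Q : resolution N) (u : {linear M -> N}) :
  exists f, chain_map f /\
    forall x, augm Q (f 0 x) = u (augm P x) :> N.
Proof.
pose good n (f : {linear term P n -> term Q n}) :=
  forall y, exists z, diff Q n z = f (diff P n y).
have step n (f : {f | @good n f}) :
    {g : {linear term P n.+1 -> term Q n.+1} |
      good n.+1 g /\ forall x, diff Q n (g x) = sval f (diff P n x)}.
  apply: cid; have [g gP] := @term_projective _ _ P n.+1 _ _ (diff Q n)
    (sval f \o diff P n) (svalP f).
  exists g; split=> // y; apply/diff_exact; rewrite gP /= diff_diff.
  exact: linear0.
have [|f0 f0P] := @term_projective _ _ P 0 _ _ (augm Q) (u \o augm P).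
  by move=> x; exact: augm_surj.
have good0 : good 0 f0.
  by move=> y; apply/augm_exact; rewrite f0P /= augm_diff linear0.
pose F := fix F n : {f | @good n f} :=
  if n is m.+1 return {f | @good n f}
  then exist _ (sval (step m (F m))) (proj1 (svalP (step m (F m))))
  else exist _ f0 good0.
exists (fun n => sval (F n)); split=> // n x.
exact: (proj2 (svalP (step n (F n)))).
Qed.

(** Only the last component s of the homotopy is carried through the induction:
    d s agrees with f on boundaries, so that in the next degree f - s d takes
    values in cycles and can be lifted again. *)
Lemma null_homotopy M N (P : resolution M) (Q : resolution N)
    (f : forall n, {linear term P n -> term Q n}) n :
  chain_map f -> (forall x, augm Q (f 0 x) = 0) ->
  exists s : {linear term P n -> term Q n.+1},
    match n return ({linear term P n -> term Q n.+1} -> Prop) with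
    | 0 => fun s => forall x, f 0 x = diff Q 0 (s x)
    | m.+1 => fun s => exists t : {linear term P m -> term Q m.+1},
        forall x, f m.+1 x = diff Q m.+1 (s x) + t (diff P m x)
    end s.
Proof.
move=> fd f0; elim: n => [|n [s sP]].
  have [|s sP] := @term_projective _ _ P 0 _ _ (diff Q 0) (f 0); last by exists s.
  by move=> x; apply/augm_exact.
have fdE y : f n (diff P n y) = diff Q n (s (diff P n y)).
  case: n => [|n] in s sP y *; first by rewrite sP.
  by have [t ->] := sP; rewrite diff_diff linear0 addr0.
have [x|s' s'P] := @term_projective _ _ P n.+1 _ _ (diff Q n.+1)
  (f n.+1 \- (s \o diff P n)).
  by apply/diff_exact; rewrite /= linearB fd fdE subrr.
by exists s', s => x; rewrite s'P /= subrK.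
Qed.

(** The form in which uniqueness of comparison maps is used: on cocycles, two
    lifts of the same map differ by coboundaries. *)
Lemma null_homotopic_cocycle M N X (P : resolution M) (Q : resolution N)
    (f : forall n, {linear term P n -> term Q n}) n (h : {linear term Q n -> X}) :
  chain_map f -> (forall x, augm Q (f 0 x) = 0) ->
  (forall x, h (diff Q n x) = 0) -> coboundary (h \o f n).
Proof.
move=> fd f0 dh; have [s] := null_homotopy n fd f0.
case: n => [|n] in h dh s *; first by move=> sP x /=; rewrite sP dh.
by move=> [t tP]; exists (h \o t) => x; rewrite /= tP linearD dh add0r.
Qed.

Definition std_resolution M : resolution M.
Proof.
refine (@Resolution R M (fun n => res n M) (fun n => bd n M) (aug M) _ _ _ _).
- by move=> n; exact: projective_freemod.
- by move=> x; exists << x >>; exact: augU.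
- exact: res_exact0.
- by move=> n x; exact: (@res_exact R n M x).
Defined.

Lemma bd_bd M n x : bd n M (bd n.+1 M x) = 0.
Proof. exact: (diff_diff (P := std_resolution M) (n := n) x). Qed.

Lemma freemod_mapU M N (u : {linear M -> N}) x :
  freemod_map u << x >> = << u x >> :> freemod N.
Proof. by rewrite /= liftU scale1r. Qed.

Lemma freemod_map_comp M N L (u : {linear N -> L}) (v : {linear M -> N})
    (w : {linear M -> L}) :
  w =1 u \o v -> forall x, freemod_map w x = freemod_map u (freemod_map v x).
Proof.
move=> e x; apply: (linear_freeg (g := freemod_map u \o freemod_map v)) => k.
by rewrite [RHS]/= -/(freemod_map _ _) !freemod_mapU e.
Qed.

Lemma syzn_map_comp M N L (u : {linear N -> L}) (v : {linear M -> N})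
    (w : {linear M -> L}) n :
  w =1 u \o v -> syzn_map w n =1 syzn_map u n \o syzn_map v n.
Proof.
by move=> e; elim: n => // n IH x; apply: val_inj; exact: (freemod_map_comp IH).
Qed.

Lemma res_map_comp M N L (u : {linear N -> L}) (v : {linear M -> N})
    (w : {linear M -> L}) n x :
  w =1 u \o v -> res_map w n x = res_map u n (res_map v n x).
Proof. by move=> e; rewrite /res_map; apply: freemod_map_comp; exact: syzn_map_comp. Qed.

Lemma freemod_map_eq M N (u v : {linear M -> N}) :
  u =1 v -> freemod_map u =1 freemod_map v.
Proof. by move=> e; apply: linear_freeg => k; rewrite !freemod_mapU e. Qed.

Lemma syzn_map_eq M N (u v : {linear M -> N}) n :
  u =1 v -> syzn_map u n =1 syzn_map v n.
Proof.
by move=> e; elim: n => // n IH x; apply: val_inj; exact: (freemod_map_eq IH).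
Qed.

Lemma res_map_eq M N (u v : {linear M -> N}) n :
  u =1 v -> res_map u n =1 res_map v n.
Proof. by move=> e; rewrite /res_map; apply: freemod_map_eq; exact: syzn_map_eq. Qed.

Lemma freemod_map_id M x : freemod_map (idfun : {linear M -> M}) x = x.
Proof. by apply: (linear_freeg (g := idfun)) => k; rewrite freemod_mapU. Qed.

Lemma syzn_map_id M n : syzn_map (idfun : {linear M -> M}) n =1 idfun.
Proof.
elim: n => // n IH x; apply: val_inj => /=.
by rewrite -[RHS]freemod_map_id; exact: (freemod_map_eq (v := idfun) IH).
Qed.

Lemma res_map_id M n x : res_map (idfun : {linear M -> M}) n x = x.
Proof.
rewrite -[RHS]freemod_map_id; exact: (freemod_map_eq (v := idfun) (@syzn_map_id M n)).
Qed.

Lemma freemod_map_surj M N (u : {linear M -> N}) :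
  (forall y, exists x, u x = y) -> forall y, exists x, freemod_map u x = y.
Proof.
move=> surj_u y; have [s sK] := choice surj_u.
exists (fglift (fun z => << s z >> : freemod M) y).
apply: (linear_freeg (f := freemod_map u \o
  (fglift (fun z => << s z >> : freemod M) : {linear freemod N -> _})) (g := idfun)).
move=> k; transitivity (freemod_map u << s k >>); last by rewrite freemod_mapU sK.
by congr (freemod_map u _); rewrite /= liftU scale1r.
Qed.

(** A preimage x of y in the free module need not be a syzygy, but aug x lies in
    the kernel of u, so that << aug x >> - << 0 >> maps to zero and can be
    subtracted from x. *)
Lemma syz_map_surj M N (u : {linear M -> N}) :
  (forall y, exists x, u x = y) -> forall y, exists x, syz_map u x = y.
Proof.
move=> surj_u y; have [x ux] := freemod_map_surj surj_u (val y).
have y0 : aug N (val y) = 0.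
  by have /(smemP (kernel (aug N))) := submod_mem y.
pose x' : freemod M := x - << aug M x >> + << 0 >>.
have x'0 : aug M x' = 0.
  by rewrite linearD linearB !augU subrr addr0.
exists (Submod (introT (smemP (kernel (aug M)) x') x'0)); apply: val_inj.
transitivity (freemod_map u x') => //.
rewrite linearD linearB !freemod_mapU ux -aug_natural ux.
by rewrite y0 linear0 subrK.
Qed.

Lemma res_map_surj M N (u : {linear M -> N}) n :
  (forall y, exists x, u x = y) -> forall y, exists x, res_map u n x = y.
Proof.
move=> surj_u; apply: freemod_map_surj.
by elim: n => // n IH; exact: syz_map_surj.
Qed.
End Comparison.

(** * Ext through cocycles on the standard resolution *)

Section ExtElements.
Variable R : comNzRingType.
Implicit Types L M N X : lmodType R.

(** Cochains are taken as plain functions, so that equalities between them are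
    pointwise equalities. *)
Definition represents n M X (h : res n M -> X) (z : Ext n M X) : Prop :=
  exists H : submod (cocycles n M X), val (val H) = h /\ qpi _ H = z.

Lemma represents_surj n M X (z : Ext n M X) :
  exists h : {linear res n M -> X}, represents h z.
Proof.
have [H <-] := qpi_surj z; have /smemP lH := submod_mem (val H).
by exists (linear_pack lH), H.
Qed.

Lemma represents_cocycle n M X (h : res n M -> X) z :
  represents h z -> forall x, h (bd n M x) = 0.
Proof.
move=> [H [<- _]] x; have /smemP/(congr1 val) dH := submod_mem H.
exact: (congr1 (fun f => f x) dH).
Qed.

Lemma represents_total n M X (h : {linear res n M -> X}) :
  (forall x, h (bd n M x) = 0) -> exists z, represents h z.
Proof.
move=> dh.
have lh : linear_maps (res n M) X h by move=> c x y; rewrite linearP.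
pose H : Defs.Hom (res n M) X := Submod (introT (smemP _ _) lh).
have dH : cocycles n M X H.
  by apply: val_inj; apply: functional_extensionality_dep => x; exact: dh.
by exists (qpi _ (Submod (introT (smemP _ _) dH))); exists (Submod (introT (smemP _ _) dH)).
Qed.

Lemma represents_linear n M X (h h' h'' : res n M -> X) (c : R) z z' :
  represents h z -> represents h' z' -> (forall x, h'' x = c *: h x + h' x) ->
  represents h'' (c *: z + z').
Proof.
move=> [H [<- <-]] [H' [<- <-]] e; exists (c *: H + H'); split.
  apply: functional_extensionality_dep => x; rewrite e.
  have -> : val (c *: H + H') = c *: val H + val H' by rewrite linearP.
  have -> : val (c *: val H + val H') = c *: val (val H) + val (val H') by rewrite linearP.
  by [].
by rewrite linearP.
Qed.

Lemma coboundariesP n M X (H : Defs.Hom (res n M) X) :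
  coboundaries n M X H <-> coboundary (P := std_resolution M) (n := n) (val H).
Proof.
case: n H => [|n] H /=.
  split=> [-> //|H0]; apply: val_inj; apply: functional_extensionality_dep => x.
  exact: H0.
split=> [[G <-]|[g gP]].
  have /smemP lG := submod_mem G.
  by exists (linear_pack lG).
have lg : linear_maps (res n M) X g by move=> c x y; rewrite linearP.
exists (Submod (introT (smemP _ _) lg)); apply: val_inj.
by apply: functional_extensionality_dep => x; exact/esym/gP.
Qed.

Lemma represents_eq0 n M X (h : res n M -> X) z :
  represents h z -> z = 0 <-> coboundary (P := std_resolution M) (n := n) h.
Proof.
move=> [H [<- <-]]; rewrite -coboundariesP; split.
  by rewrite -[0 in X in X -> _](linear0 (qpi _)) => /qpi_eq; rewrite subr0.
by move=> BH; rewrite -[RHS](linear0 (qpi _)); apply/qpi_eq; rewrite subr0.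
Qed.

Lemma represents_map n M N X (u : {linear M -> N}) (h : res n N -> X) z :
  represents h z -> represents (h \o res_map u n) (Ext_map X u n z).
Proof.
move=> [H [<- <-]].
exists (submod_map (@cochain_cocycles R M N X u n) H); split=> //.
by rewrite /Ext_map /subquot_map /= quotmod_mapE.
Qed.

Lemma represents_inj n M X (h : res n M -> X) z z' :
  represents h z -> represents h z' -> z = z'.
Proof.
move=> rz rz'; apply/eqP; rewrite -subr_eq0 addrC -scaleN1r.
have r0 : represents (fun=> 0) (-1 *: z' + z).
  by apply: (represents_linear rz' rz) => x; rewrite scaleN1r addNr.
apply/eqP/(represents_eq0 r0).
by case: n {h z z' rz rz' r0} => [|n] //=; exists (\0 : {linear _ -> X}).
Qed.

Lemma represents_ext n M X (h h' : res n M -> X) z :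
  represents h z -> h =1 h' -> represents h' z.
Proof. by move=> r /(@functional_extensionality_dep _ _ h h') <-. Qed.

Lemma represents_coboundary n M X (h h' : {linear res n M -> X}) z :
  represents h z -> coboundary (P := std_resolution M) (n := n) (h' \- h) ->
  represents h' z.
Proof.
move=> hz cob; have dh := represents_cocycle hz.
have dd0 x : h' (bd n M x) = 0.
  suff : (h' \- h) (bd n M x) = 0 by rewrite /= dh subr0.
  case: n h h' z hz cob dh x => [|n] h h' z hz cob dh x; first exact: cob.
  have [g ->] := cob; rewrite -[diff _ n _]/(bd n M _).
  have -> : bd n M (bd n.+1 M x) = 0 by apply/res_exact; exists x.
  exact: linear0.
have [z' hz'] := represents_total dd0; suff -> : z = z' by [].
apply/eqP; rewrite -subr_eq0 -oppr_eq0 opprB addrC -scaleN1r; apply/eqP.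
apply/(represents_eq0 (h := h' \- h)) => //.
by apply: (represents_linear hz hz') => x; rewrite scaleN1r addrC.
Qed.

Lemma Ext_map_comp n L M N X (u : {linear M -> N}) (v : {linear L -> M})
    (w : {linear L -> N}) :
  w =1 u \o v -> forall z, Ext_map X w n z = Ext_map X v n (Ext_map X u n z).
Proof.
move=> e z; have [h hz] := represents_surj z.
apply: represents_inj (represents_map w hz) _.
apply: represents_ext (represents_map v (represents_map u hz)) _ => x /=.
by congr (h _); exact/esym/res_map_comp.
Qed.

Lemma Ext_map_eq n M N X (u v : {linear M -> N}) :
  u =1 v -> Ext_map X u n =1 Ext_map X v n.
Proof.
move=> e z; have [h hz] := represents_surj z.
apply: represents_inj (represents_map u hz) _.
apply: represents_ext (represents_map v hz) _ => x /=.
by congr (h _); exact/esym/res_map_eq.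
Qed.

Lemma Ext_map_id n M X z : Ext_map X (idfun : {linear M -> M}) n z = z.
Proof.
have [h hz] := represents_surj z.
apply: represents_inj (represents_map _ hz) _.
by apply: represents_ext hz _ => x /=; congr (h _); rewrite -[LHS](res_map_id (n := n)).
Qed.

(** The standard resolution is functorial but not additive.  The defect of
    linearity is a chain map that lifts the zero map, hence vanishes on
    cohomology. *)
Lemma Ext_map_linear n M N X (u v w : {linear M -> N}) (c : R) :
  (forall x, w x = c *: u x + v x) ->
  forall z, Ext_map X w n z = c *: Ext_map X u n z + Ext_map X v n z.
Proof.
move=> e z; have [h hz] := represents_surj z.
pose f m : {linear term (std_resolution M) m -> term (std_resolution N) m} :=
  (res_map w m \- (c \*: res_map u m \+ res_map v m)).
have fE m x : f m x = res_map w m x - (c *: res_map u m x + res_map v m x) by [].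
have chain_f : chain_map f.
  move=> m x; rewrite !fE.
  rewrite -[diff _ m]/(bd m N) linearB linearD linearZ_LR.
  by rewrite !bd_natural.
have f0 x : augm (std_resolution N) (f 0 x) = 0.
  rewrite fE -[augm _]/(aug N) linearB linearD linearZ_LR.
  by rewrite !aug_natural [w _]e subrr.
have := null_homotopic_cocycle (Q := std_resolution N) (n := n) (h := h)
  chain_f f0 (represents_cocycle hz).
have rep := represents_linear (c := c) (represents_map u hz) (represents_map v hz)
  (fun x => erefl (c *: (h \o res_map u n) x + (h \o res_map v n) x)).
move=> cob; apply/eqP; rewrite -subr_eq0 addrC -scaleN1r; apply/eqP.
apply/(represents_eq0 (h := h \o f n)) => //.
apply: (represents_linear rep (represents_map w hz)) => x.
by rewrite /= linearB linearD linearZ_LR scaleN1r addrC.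
Qed.

Lemma Ext_map0 n M N X (z : Ext n N X) : Ext_map X (\0 : {linear M -> N}) n z = 0.
Proof.
have H (x : M) : (\0 : {linear M -> N}) x = 1 *: \0 x + \0 x by rewrite scaler0 addr0.
by have /eqP := Ext_map_linear H z; rewrite scale1r -subr_eq0 opprD addNKr oppr_eq0 => /eqP.
Qed.

(** Degree 0 has no coboundaries, and the map of resolutions is surjective. *)
Lemma Ext_map0_inj M N X (u : {linear M -> N}) (z : Ext 0 N X) :
  (forall y, exists x, u x = y) -> Ext_map X u 0 z = 0 -> z = 0.
Proof.
move=> surj_u; have [h hz] := represents_surj z.
move=> /(represents_eq0 (represents_map u hz)) h0; apply/(represents_eq0 hz) => y.
by have [x <-] := res_map_surj (n := 0) surj_u y; exact: h0.
Qed.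

(** A section s of the augmentation gives a chain map lifting zero that is
    1 - s aug in degree 0 and the identity in all higher degrees; so every
    cocycle of positive degree is a coboundary. *)
Lemma Ext_projective n M X (z : Ext n.+1 M X) : projective M -> z = 0.
Proof.
move=> projM; have [s sK] : exists s : {linear M -> freemod M}, forall x, aug M (s x) = x.
  by apply: (projM _ _ (aug M) idfun) => x; exists << x >>; exact: augU.
pose f m : {linear term (std_resolution M) m -> term (std_resolution M) m} :=
  match m return {linear res m M -> res m M} with
  | 0 => idfun \- (s \o aug M)
  | m.+1 => idfun
  end.
have chain_f : chain_map f.
  move=> [|m] x //; rewrite [LHS]/= -[bd 0 M x]/(bd 0 M x).
  have -> : f 0 (diff (std_resolution M) 0 x) = bd 0 M x - s (aug M (bd 0 M x)) by [].
  have -> : aug M (bd 0 M x) = 0 by apply/res_exact0; exists x.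
  by rewrite linear0 subr0.
have f0 x : augm (std_resolution M) (f 0 x) = 0.
  have -> : augm (std_resolution M) (f 0 x) = aug M (x - s (aug M x)) by [].
  by rewrite linearB sK subrr.
have [h hz] := represents_surj z.
apply/(represents_eq0 hz).
exact: (null_homotopic_cocycle (Q := std_resolution M) (n := n.+1) (h := h)
  chain_f f0 (represents_cocycle hz)).
Qed.

End ExtElements.

(** * The kernel resolution of a short exact sequence *)

Section LongExactSequence.
Variable R : comNzRingType.
Implicit Types L M N X : lmodType R.

Section KernelResolution.
Variables (A B C : lmodType R) (i : {linear A -> B}) (p : {linear B -> C}).
Hypothesis exact_ip : short_exact i p.

(** In each degree the map res B -> res C is a surjection onto a free module, so
    its kernel is projective; the kernels resolve A. *)
Definition ker_res n : lmodType R := submod (kernel (res_map p n)).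

Lemma ker_res_val n (q : ker_res n) : res_map p n (val q) = 0.
Proof. by have /smemP := submod_mem q. Qed.

Definition ker_res_Sub n x (px : res_map p n x = 0) : ker_res n :=
  Submod (introT (smemP (kernel (res_map p n)) x) px).

Fact ker_res_bd n x :
  kernel (res_map p n.+1) x -> kernel (res_map p n) (bd n B x).
Proof.
move=> px; change (res_map p n (bd n B x) = 0); rewrite -bd_natural.
by have -> : res_map p n.+1 x = 0 by []; rewrite linear0.
Qed.

Definition ker_res_diff n : {linear ker_res n.+1 -> ker_res n} :=
  submod_map (@ker_res_bd n).

Lemma res_map_section n :
  exists s : {linear res n C -> res n B}, forall x, res_map p n (s x) = x.
Proof.
have [_ surj_p _] := exact_ip.
apply: (@projective_freemod R (syzn n C) _ _ (res_map p n) idfun).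
exact: res_map_surj.
Qed.

Lemma ker_res_retract n :
  exists r : {linear res n B -> ker_res n}, forall q, r (val q) = q.
Proof.
have [s sK] := res_map_section n.
have [|y|r rP] := linear_lift (i := incl (kernel (res_map p n)))
  (g := idfun \- (s \o res_map p n)).
- exact: val_inj.
- have py : res_map p n (y - s (res_map p n y)) = 0 by rewrite linearB sK subrr.
  by exists (ker_res_Sub py).
by exists r => q; apply: val_inj; rewrite [LHS]rP /= ker_res_val linear0 subr0.
Qed.

(** If c is the image of b, then c is a cycle, hence a boundary; lifting a
    primitive of c to B and subtracting its boundary from b moves b into the
    kernel. *)
Lemma ker_res_boundary n (b : res n.+1 B) :
  res_map p n (bd n B b) = 0 -> exists q : ker_res n.+1, bd n B (val q) = bd n B b.
Proof.
have [_ surj_p _] := exact_ip => pb.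
have /(res_exact (M := C)) [c dc] : bd n C (res_map p n.+1 b) = 0.
  by rewrite bd_natural.
have [b' pb'] := res_map_surj surj_p c.
have pbb' : res_map p n.+1 (b - bd n.+1 B b') = 0.
  by rewrite linearB -bd_natural pb' dc subrr.
exists (ker_res_Sub pbb'); change (bd n B (b - bd n.+1 B b') = bd n B b); rewrite linearB.
by have -> : bd n B (bd n.+1 B b') = 0 by [apply/res_exact; exists b']; rewrite subr0.
Qed.

Lemma ker_res_augm_exists :
  exists e : {linear ker_res 0 -> A}, forall q, i (e q) = aug B (val q).
Proof.
have [inj_i _ exact_B] := exact_ip.
apply: (linear_lift (g := aug B \o incl _) inj_i) => q; apply/exact_B.
change (p (aug B (val q)) = 0); rewrite -aug_natural.
have -> : freemod_map p (val q) = 0 by exact: (@ker_res_val 0).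
exact: linear0.
Qed.

Definition ker_res_augm : {linear ker_res 0 -> A} := sval (cid ker_res_augm_exists).

Lemma ker_res_augmE q : i (ker_res_augm q) = aug B (val q).
Proof. exact: (svalP (cid ker_res_augm_exists)). Qed.

(** The composite of i and p is zero, but the standard resolution does not carry
    the zero map to zero: it sends << x >> to << 0 >>.  Subtracting the map
    induced by zero makes the image of A land in the kernel resolution. *)
Definition theta n : {linear res n A -> res n B} :=
  res_map i n \- res_map (\0 : {linear A -> B}) n.

Lemma thetaE n x :
  theta n x = res_map i n x - res_map (\0 : {linear A -> B}) n x.
Proof. by []. Qed.

Lemma theta_bd n x : theta n (bd n A x) = bd n B (theta n.+1 x).
Proof. by rewrite !thetaE linearB !bd_natural. Qed.

Lemma theta_ker n x : res_map p n (theta n x) = 0.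
Proof.
have [_ _ exact_B] := exact_ip.
rewrite thetaE linearB.
rewrite -(res_map_comp (w := \0 : {linear A -> C})); last first.
  by move=> a /=; apply/esym/exact_B; exists a.
rewrite -(res_map_comp (w := \0 : {linear A -> C})) ?subrr //.
by move=> a /=; rewrite linear0.
Qed.

Lemma theta_lift_exists n :
  exists t : {linear res n A -> ker_res n}, forall x, val (t x) = theta n x.
Proof.
apply: (linear_lift (i := incl _)); first exact: val_inj.
by move=> x; exists (ker_res_Sub (theta_ker x)).
Qed.

Definition theta_lift n : {linear res n A -> ker_res n} :=
  sval (cid (theta_lift_exists n)).

Lemma theta_liftE n x : val (theta_lift n x) = theta n x.
Proof. exact: (svalP (cid (theta_lift_exists n))). Qed.

Lemma ker_res_projective n : projective (ker_res n).
Proof.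
have [r rK] := ker_res_retract n.
exact: (projective_retract (s := incl (kernel (res_map p n))) (r := r)
  (@projective_freemod R (syzn n B)) rK).
Qed.

Lemma ker_res_augm_surj x : exists q, ker_res_augm q = x.
Proof.
have [inj_i _ _] := exact_ip.
exists (theta_lift 0 << x >>); apply: inj_i.
rewrite ker_res_augmE theta_liftE thetaE linearB !aug_natural augU.
by rewrite subr0.
Qed.

Lemma ker_res_augm_exact q :
  ker_res_augm q = 0 <-> exists q', ker_res_diff 0 q' = q.
Proof.
have [inj_i _ _] := exact_ip; split=> [q0|[q' <-]]; last first.
  apply: inj_i; rewrite ker_res_augmE linear0.
  by apply/res_exact0; exists (val q').
have /res_exact0 [b db] : aug B (val q) = 0 by rewrite -ker_res_augmE q0 linear0.
have [|q' dq'] := @ker_res_boundary 0 b; first by rewrite db ker_res_val.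
by exists q'; apply: val_inj; rewrite [LHS]dq'.
Qed.

Lemma ker_res_diff_exact n q :
  ker_res_diff n q = 0 <-> exists q', ker_res_diff n.+1 q' = q.
Proof.
split=> [/(congr1 val) q0|[q' <-]]; last first.
  by apply: val_inj; apply/res_exact; exists (val q').
have /res_exact [b db] : bd n B (val q) = 0 by [].
have [|q' dq'] := @ker_res_boundary n.+1 b; first by rewrite db ker_res_val.
by exists q'; apply: val_inj; rewrite [LHS]dq'.
Qed.

Definition ker_resolution : resolution A :=
  Resolution ker_res_projective ker_res_augm_surj ker_res_augm_exact
    ker_res_diff_exact.

End KernelResolution.
End LongExactSequence.

(** * The connecting map of Ext *)

Section Connecting.
Variable R : comNzRingType.
Implicit Types L M N X : lmodType R.

(** The classical zigzag: e extends the cocycle f from A to B, and its coboundary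
    descends to the cocycle g on C.  As no choice of splitting enters, the
    relation is natural in the short exact sequence on the nose. *)
Definition connects (A B C X : lmodType R) (i : {linear A -> B}) (p : {linear B -> C}) n
    (z : Ext n A X) (y : Ext n.+1 C X) : Prop :=
  exists (e : {linear res n B -> X}) (f : {linear res n A -> X})
         (g : {linear res n.+1 C -> X}),
  [/\ represents f z, represents g y, forall x, e (theta i n x) = f x
    & forall x, e (bd n B x) = g (res_map p n.+1 x)].

(** The zero map acts as zero on Ext, so [i] and [theta i] induce the same map. *)
Lemma represents_theta (A B X : lmodType R) (i : {linear A -> B}) n
    (h : {linear res n B -> X}) (z : Ext n B X) :
  represents h z -> represents (h \o theta i n) (Ext_map X i n z).
Proof.
move=> hz.
have -> : Ext_map X i n z = -1 *: Ext_map X (\0 : {linear A -> B}) n z + Ext_map X i n z.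
  by rewrite Ext_map0 scaler0 add0r.
apply: (represents_linear (represents_map \0 hz) (represents_map i hz)) => x.
transitivity (h (theta i n x)) => //.
by rewrite thetaE linearB scaleN1r addrC.
Qed.

Lemma connects_linear (A B C X : lmodType R) (i : {linear A -> B}) (p : {linear B -> C}) n
    (c : R) (z z' : Ext n A X) (y y' : Ext n.+1 C X) :
  connects i p z y -> connects i p z' y' ->
  connects i p (c *: z + z') (c *: y + y').
Proof.
move=> [e [f [g [fz gy eth ebd]]]] [e' [f' [g' [fz' gy' eth' ebd']]]].
exists (c \*: e \+ e'), (c \*: f \+ f'), (c \*: g \+ g'); split.
- exact: represents_linear fz fz' _.
- exact: represents_linear gy gy' _.
- by move=> x; rewrite /= -/(theta i n x) eth eth'.
- by move=> x; rewrite [LHS]/= -/(bd n B x) ebd ebd'.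
Qed.

Lemma connects_natural (A B C A' B' C' X : lmodType R)
    (i : {linear A -> B}) (p : {linear B -> C})
    (i' : {linear A' -> B'}) (p' : {linear B' -> C'})
    (al : {linear A' -> A}) (be : {linear B' -> B}) (ga : {linear C' -> C}) n
    (z : Ext n A X) (y : Ext n.+1 C X) :
  i \o al =1 be \o i' -> p \o be =1 ga \o p' -> connects i p z y ->
  connects i' p' (Ext_map X al n z) (Ext_map X ga n.+1 y).
Proof.
move=> sq_i sq_p [e [f [g [fz gy eth ebd]]]].
exists (e \o res_map be n), (f \o res_map al n), (g \o res_map ga n.+1); split.
- exact: represents_map.
- exact: represents_map.
- move=> x; rewrite [RHS]/= -eth !thetaE.
  have -> : res_map i n (res_map al n x) = res_map be n (res_map i' n x).
    by rewrite -!(res_map_comp (w := be \o i')) // => ? /=; exact/esym/sq_i.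
  have -> : res_map (\0 : {linear A -> B}) n (res_map al n x) =
            res_map be n (res_map (\0 : {linear A' -> B'}) n x).
    by rewrite -!(res_map_comp (w := \0 : {linear A' -> B})) // => ? /=; rewrite linear0.
  by rewrite -linearB.
- move=> x; rewrite [LHS]/= -bd_natural ebd.
  transitivity (g (res_map (ga \o p') n.+1 x)); congr (g _).
    by apply/esym/res_map_comp => ? /=; exact/esym/sq_p.
  exact: res_map_comp.
Qed.

Lemma connects_pullback (A B C X : lmodType R) (i : {linear A -> B})
    (p : {linear B -> C}) n (w : Ext n B X) :
  connects i p (Ext_map X i n w) 0.
Proof.
have [h hw] := represents_surj w.
exists h, (h \o theta i n), \0; split=> //.
- exact: represents_theta.
- have [z z0] : exists z, represents (\0 : {linear res n.+1 C -> X}) z.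
    exact: represents_total.
  suff -> : 0 = z by [].
  by apply/esym/(represents_eq0 z0); exists \0.
- by move=> x; rewrite (represents_cocycle hw).
Qed.

Lemma connects_pushforward (A B C X : lmodType R) (i : {linear A -> B})
    (p : {linear B -> C}) n (z : Ext n A X) (y : Ext n.+1 C X) :
  connects i p z y -> Ext_map X p n.+1 y = 0.
Proof.
move=> [e [f [g [_ gy _ ebd]]]]; apply/(represents_eq0 (represents_map p gy)).
by exists e => x; rewrite [RHS]ebd.
Qed.

Section Exactness.
Variables (A B C X : lmodType R) (i : {linear A -> B}) (p : {linear B -> C}).
Hypothesis exact_ip : short_exact i p.
Implicit Types n : nat.

Let Q := ker_resolution exact_ip.
Let th n : {linear res n A -> term Q n} := theta_lift exact_ip n.

Let surj_p n y : exists x, res_map p n x = y.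
Proof. by have [_ sp _] := exact_ip; exact: res_map_surj. Qed.

Let th_chain : chain_map (P := std_resolution A) (Q := Q) th.
Proof.
move=> n x; apply: val_inj; rewrite [RHS]theta_liftE theta_bd.
by congr (bd n B _); exact: theta_liftE.
Qed.

Let th_augm x : augm Q (th 0 x) = aug A x.
Proof.
have [inj_i _ _] := exact_ip; apply: inj_i.
by rewrite ker_res_augmE theta_liftE thetaE linearB !aug_natural subr0.
Qed.

Let extend n (h : {linear term Q n -> X}) :
  exists e : {linear res n B -> X}, forall q : term Q n, e (val q) = h q.
Proof.
have [r rK] := ker_res_retract exact_ip n.
by exists (h \o r) => q; rewrite /= rK.
Qed.

Let kernel_sub n x : res_map p n x = 0 -> exists q : term Q n, val q = x.
Proof. by move=> px; exists (ker_res_Sub px). Qed.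

(** Pull f back along a comparison map from the kernel resolution to the standard
    one, and extend the result to B by the degreewise splitting.  Restricting
    back to A changes f by a coboundary, by uniqueness of comparison maps. *)
Lemma connects_total n (z : Ext n A X) : exists y, connects i p z y.
Proof.
have [f fz] := represents_surj z; have df := represents_cocycle fz.
have [psi [psi_chain psi0]] := comparison_lift Q (std_resolution A) idfun.
have [e eP] := extend (f \o psi n).
have ede (q : term Q n.+1) : e (bd n B (val q)) = 0.
  have -> : bd n B (val q) = val (diff Q n q) by [].
  by rewrite eP /= -psi_chain; exact: df.
have [|g gP] := linear_factor (p := res_map p n.+1) (g := e \o bd n B) (@surj_p _).
  by move=> x /kernel_sub [q <-]; exact: ede.
have dg x : g (bd n.+1 C x) = 0.
  have [b <-] := surj_p x; rewrite bd_natural gP.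
  by change (e (bd n B (bd n.+1 B b)) = 0); rewrite bd_bd linear0.
have [y gy] := represents_total dg; exists y.
pose f' := e \o theta i n : {linear res n A -> X}.
have cob : coboundary (P := std_resolution A) (n := n) (f' \- f).
  pose k m : {linear term (std_resolution A) m -> term (std_resolution A) m} :=
    (psi m \o th m) \- idfun.
  have kE m x : k m x = psi m (th m x) - x by [].
  have k_chain : chain_map k.
    by move=> m x; rewrite !kE linearB psi_chain th_chain.
  have k0 x : augm (std_resolution A) (k 0 x) = 0.
    rewrite kE linearB psi0 -[augm (std_resolution A) x]/(aug A x).
    by rewrite [augm Q _]th_augm subrr.
  have := null_homotopic_cocycle (Q := std_resolution A) (n := n) (h := f) k_chain k0 df.
  have -> // : f \o k n = f' \- f.
  apply: functional_extensionality_dep => x.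
  transitivity (f (psi n (th n x)) - f x); first exact: linearB.
  by congr (_ - _); rewrite -[RHS]/(e (theta i n x)) -(theta_liftE exact_ip) eP.
by exists e, f', g; split=> //; exact: represents_coboundary fz cob.
Qed.

(** The restriction of e to the kernel resolution is a cocycle that becomes a
    coboundary on A, hence is one, by comparison in both directions.  Correcting
    e by an extension of a primitive makes it vanish on the kernel without
    changing its coboundary, so that it descends to a primitive of g on C. *)
Lemma connects_eq0 n (y : Ext n.+1 C X) : connects i p (0 : Ext n A X) y -> y = 0.
Proof.
move=> [e [f [g [f0 gy eth ebd]]]]; apply/(represents_eq0 gy).
have {f0} cob_f : coboundary (P := std_resolution A) (n := n) f.
  exact/(represents_eq0 f0).
have [psi [psi_chain psi0]] := comparison_lift Q (std_resolution A) idfun.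
pose h : {linear term Q n -> X} := e \o incl (kernel (res_map p n)).
have hE (q : term Q n) : h q = e (val q) by [].
have dh (q : term Q n.+1) : h (diff Q n q) = 0.
  have -> : h (diff Q n q) = e (bd n B (val q)) by [].
  by rewrite ebd ker_res_val linear0.
pose k m : {linear term Q m -> term Q m} := idfun \- (th m \o psi m).
have kE m x : k m x = x - th m (psi m x) by [].
have k_chain : chain_map k.
  by move=> m x; rewrite !kE linearB th_chain psi_chain.
have k0 x : augm Q (k 0 x) = 0.
  rewrite kE linearB [augm Q (th 0 _)]th_augm.
  by have -> : aug A (psi 0 x) = augm Q x by [exact: psi0]; rewrite subrr.
have cob_k := null_homotopic_cocycle (n := n) (h := h) k_chain k0 dh.
have hk (q : term Q n) : h q = (h \o k n) q + f (psi n q).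
  rewrite -eth -(theta_liftE exact_ip) -hE.
  transitivity (h (k n q + th n (psi n q))); last exact: linearD.
  by rewrite kE subrK.
(* e' is a cocycle on B with the same restriction to the kernel resolution as e. *)
suff [e' e'P de'] : exists2 e' : {linear res n B -> X},
    forall q : term Q n, e' (val q) = e (val q) & forall x, e' (bd n B x) = 0.
  have [|g2 g2P] := linear_factor (p := res_map p n) (g := e \- e') (@surj_p n).
    move=> x /kernel_sub [q <-]; transitivity (e (val q) - e' (val q)) => //.
    by rewrite e'P subrr.
  exists g2 => x; have [b <-] := surj_p x.
  transitivity (g2 (res_map p n (bd n B b))); last by rewrite bd_natural.
  by rewrite g2P [RHS]/= de' subr0 ebd.
move: (h \o k n) cob_k hk => hkn; clear k kE k_chain k0 y gy.
case: n e f g eth ebd cob_f psi psi_chain psi0 h hE dh hkn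
  => [|n] e f g eth ebd cob_f psi psi_chain psi0 h hE dh hkn cob_k hk.
  exists \0 => // q; rewrite -hE hk cob_k add0r; exact/esym/cob_f.
have [f1 f1P] := cob_f; have [k1 k1P] := cob_k.
have [e1 e1P] := extend (k1 \+ (f1 \o psi n)).
exists (e1 \o bd n B) => [q|x]; last first.
  by change (e1 (bd n B (bd n.+1 B x)) = 0); rewrite bd_bd linear0.
transitivity (e1 (val (diff Q n q))) => //.
by rewrite e1P -hE hk k1P f1P /= -psi_chain.
Qed.

(** If g is the coboundary of g2, then e - g2 p is a cocycle on B with the same
    restriction to A as e. *)
Lemma connects_exact_left n (z : Ext n A X) :
  connects i p z 0 -> exists w, Ext_map X i n w = z.
Proof.
move=> [e [f [g [fz g0 eth ebd]]]].
have [g2 g2P] : coboundary (P := std_resolution C) (n := n.+1) g.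
  exact/(represents_eq0 g0).
pose e' : {linear res n B -> X} := e \- (g2 \o res_map p n).
have de' x : e' (bd n B x) = 0.
  transitivity (e (bd n B x) - g2 (res_map p n (bd n B x))) => //.
  by rewrite ebd g2P -[diff _ n _]/(bd n C _) bd_natural subrr.
have [w ew] := represents_total de'; exists w.
have e'th x : e' (theta i n x) = f x.
  transitivity (e (theta i n x) - g2 (res_map p n (theta i n x))) => //.
  by rewrite theta_ker // linear0 subr0.
apply: represents_inj _ fz.
exact: represents_ext (represents_theta i ew) e'th.
Qed.

Lemma connects_exact_right n (y : Ext n.+1 C X) :
  Ext_map X p n.+1 y = 0 -> exists z : Ext n A X, connects i p z y.
Proof.
have [g gy] := represents_surj y.
move=> /(represents_eq0 (represents_map p gy)) [e eP].
have deth x : (e \o theta i n) (bd n A x) = 0.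
  transitivity (e (diff (std_resolution B) n (theta i n.+1 x))).
    by congr (e _); exact: theta_bd.
  rewrite -eP; transitivity (g (res_map p n.+1 (theta i n.+1 x))) => //.
  by rewrite theta_ker // linear0.
have [z ez] := represents_total deth.
by exists z, e, (e \o theta i n), g; split=> // x; rewrite -[LHS]eP.
Qed.
Lemma Ext_connecting n :
  exists delta : {linear Ext n A X -> Ext n.+1 C X},
    [/\ forall z, connects i p z (delta z),
        forall z, delta z = 0 <-> exists w, Ext_map X i n w = z
      & forall y, Ext_map X p n.+1 y = 0 <-> exists z, delta z = y].
Proof.
have [delta [dP dE]] := linear_of_relation (@connects_total n)
  (fun c z y z' y' => @connects_linear _ _ _ _ i p n c z z' y y') (@connects_eq0 n).
exists delta; split=> // [z|y]; split.
- by move=> d0; apply: connects_exact_left; rewrite -d0.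
- by move=> [w <-]; apply: dE; exact: connects_pullback.
- by move=> /connects_exact_right [z zy]; exists z; exact: dE.
- by move=> [z <-]; exact: connects_pushforward (dP z).
Qed.
End Exactness.
End Connecting.

(** * Noetherian modules *)

Section Noetherian.
Variable R : comNzRingType.
Implicit Types U V : lmodType R.

Definition fg_sub V (W : submodule V) : Prop :=
  exists (n : nat) (e : 'I_n -> V), (forall i, W (e i)) /\
    forall v, W v -> exists c : 'I_n -> R, v = \sum_(i < n) c i *: e i.

Definition noetherian_module V : Prop := forall W : submodule V, fg_sub W.

Lemma submodule_sum V (W : submodule V) (I : finType) (e : I -> V) :
  (forall i, W (e i)) -> W (\sum_i e i).
Proof.
move=> We; apply: (big_ind W) => //; first exact: submodule0.
exact: submoduleD.
Qed.

Lemma submoduleN V (W : submodule V) x : W x -> W (- x).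
Proof. by move=> Wx; rewrite -scaleN1r; apply: submoduleZ. Qed.

Lemma submoduleB V (W : submodule V) x y : W x -> W y -> W (x - y).
Proof. by move=> Wx Wy; apply: submoduleD => //; exact: submoduleN. Qed.

Definition sub_inter V (W W' : submodule V) : submodule V.
Proof.
apply: (@Submodule R V (fun x => W x /\ W' x)).
- by split; exact: submodule0.
- by move=> x y [] ? ? [] ? ?; split; exact: submoduleD.
- by move=> c x [] ? ?; split; exact: submoduleZ.
Defined.

Definition sub_add V (W W' : submodule V) : submodule V.
Proof.
apply: (@Submodule R V (fun x => exists y z, [/\ W y, W' z & x = y + z])).
- by exists 0, 0; split; rewrite ?addr0 //; exact: submodule0.
- move=> _ _ [y [z [Wy Wz ->]]] [y' [z' [Wy' Wz' ->]]].
  exists (y + y'), (z + z').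
  by split; [exact: submoduleD | exact: submoduleD | rewrite addrACA].
- move=> c _ [y [z [Wy Wz ->]]].
  exists (c *: y), (c *: z).
  by split; [exact: submoduleZ | exact: submoduleZ | rewrite scalerDr].
Defined.

Definition sub_image U V (f : {linear U -> V}) (W : submodule U) : submodule V :=
  image_sub (f \o incl W).

Lemma sub_imageP U V (f : {linear U -> V}) (W : submodule U) v :
  sub_image f W v <-> exists2 u, W u & f u = v.
Proof.
split=> [[w <-]|[u Wu <-]]; first by exists (val w) => //; apply/smemP; exact: submod_mem.
by exists (Submod (introT (smemP W u) Wu)).
Qed.

Lemma fg_submod V (W : submodule V) : fg_sub W <-> finitely_generated (submod W).
Proof.
split=> [[n [e [We We_gen]]]|[n [e e_gen]]].
  exists n, (fun i => Submod (introT (smemP W _) (We i))) => v.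
  have /smemP/We_gen [c vE] := submod_mem v.
  by exists c; apply: val_inj; rewrite [LHS]vE raddf_sum.
exists n, (fun i => val (e i)); split=> [i|v Wv]; first by apply/smemP; exact: submod_mem.
have [c /(congr1 val) vE] := e_gen (Submod (introT (smemP W v) Wv)).
by exists c; rewrite [LHS]vE raddf_sum.
Qed.

(** Generators of the image, lifted to W, together with generators of the
    part of W killed by f. *)
Lemma fg_sub_extension U V (f : {linear U -> V}) (W : submodule U) :
  fg_sub (sub_image f W) -> fg_sub (sub_inter W (kernel f)) -> fg_sub W.
Proof.
move=> [n [e [We We_gen]]] [m [g [Wg Wg_gen]]].
have /choice [e' e'P] i : exists u, W u /\ f u = e i.
  by have /sub_imageP [u] := We i; exists u.
pose h (k : 'I_(n + m)) := match split k with inl i => e' i | inr j => g j end.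
exists (n + m)%N, h; split=> [k|v Wv].
  by rewrite /h; case: split => [i|j]; [have [] := e'P i | have [] := Wg j].
have [|c fvE] := We_gen (f v); first by apply/sub_imageP; exists v.
pose v' := v - \sum_i c i *: e' i.
have [|d v'E] := Wg_gen v'.
  split.
    apply: submoduleB => //; apply: submodule_sum => i; apply: submoduleZ.
    by have [] := e'P i.
  change (f v' = 0); rewrite linearB fvE linear_sum; apply/eqP; rewrite subr_eq0.
  by apply/eqP/eq_bigr => i _; rewrite linearZ_LR; have [_ ->] := e'P i.
exists (fun k => match split k with inl i => c i | inr j => d j end).
rewrite -[LHS](subrK (\sum_i c i *: e' i)) -/v' v'E addrC big_split_ord /h.
by congr (_ + _); apply: eq_bigr => k _;
  rewrite ?(unsplitK (inl _ : 'I_n + 'I_m)) ?(unsplitK (inr _ : 'I_n + 'I_m)).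
Qed.

(** Induction on the number of leading coordinates that may be nonzero; the last
    of these maps the submodule to an ideal. *)
Lemma noetherian_rV n : noetherian R -> noetherian_module 'rV[R]_n.
Proof.
move=> noethR.
suff H j (W : submodule 'rV[R]_n) :
    (forall v, W v -> forall i : 'I_n, (j <= i)%N -> v 0 i = 0) -> fg_sub W.
  by move=> W; apply: (H n) => v _ i; rewrite leqNgt ltn_ord.
elim: j W => [|j IH] W W0.
  exists 0, (fun=> 0); split=> [[]//|v Wv].
  by exists (fun=> 0); rewrite big_ord0; apply/rowP => i; rewrite mxE (W0 v).
have [jn|nj] := ltnP j n; last first.
  apply: IH => v Wv i ji; have := ltn_ord i.
  by rewrite ltnNge (leq_trans nj ji).
have lcoord : linear (fun v : 'rV[R]_n => v 0 (Ordinal jn) : R^o).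
  by move=> c x y; rewrite !mxE.
apply: (@fg_sub_extension _ _ (linear_pack lcoord)).
  exact/fg_submod/noethR.
apply: IH => v [Wv vj] i; rewrite leq_eqVlt => /orP[/eqP ij|]; last exact: W0.
by rewrite -[RHS]vj /=; congr (v 0 _); apply: val_inj.
Qed.

Lemma chain_le V (F : nat -> submodule V) :
  (forall k x, F k x -> F k.+1 x) ->
  forall k m x, (k <= m)%N -> F k x -> F m x.
Proof. by move=> FS k m x /subnK <-; elim: (m - k)%N => //= d IH /IH /FS. Qed.

Definition sub_union V (F : nat -> submodule V)
  (FS : forall k x, F k x -> F k.+1 x) : submodule V.
Proof.
apply: (@Submodule R V (fun x => exists k, F k x)).
- by exists 0%N; exact: submodule0.
- move=> x y [k Fx] [m Fy]; exists (maxn k m); apply: submoduleD.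
    exact: (chain_le FS (leq_maxl k m)).
  exact: (chain_le FS (leq_maxr k m)).
- by move=> c x [k Fx]; exists k; exact: submoduleZ.
Defined.

Lemma noetherian_chain V (F : nat -> submodule V) :
  noetherian_module V -> (forall k x, F k x -> F k.+1 x) ->
  exists k, forall m x, F m x -> F k x.
Proof.
move=> noethV FS; have [n [e [Fe Fgen]]] := noethV (sub_union FS).
have /choice [b bP] (i : 'I_n) : exists k, F k (e i) by exact: (Fe i).
exists (\max_i b i)%N => m x Fx; have [|c ->] := Fgen x; first by exists m.
apply: submodule_sum => i; apply: submoduleZ; apply: (chain_le FS _ (bP i)).
exact: leq_bigmax.
Qed.

Lemma noetherian_maximal V (Phi : submodule V -> Prop) (W : submodule V) :
  noetherian_module V -> Phi W ->
  exists2 N, Phi N & forall N', Phi N' -> (forall x, N x -> N' x) ->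
    forall x, N' x -> N x.
Proof.
move=> noethV PhiW; apply: contrapT => noMax.
have step (N : {N | Phi N}) : {N' : {N | Phi N} |
    (forall x, sval N x -> sval N' x) /\ exists x, sval N' x /\ ~ sval N x}.
  apply: cid; apply: contrapT => noN; apply: noMax; exists (sval N); first exact: svalP.
  move=> N' PhiN' NN' x N'x; apply: contrapT => Nx; apply: noN.
  by exists (exist _ N' PhiN'); split=> //; exists x.
pose F k := iter k (fun N => sval (step N)) (exist _ W PhiW).
have [|k kP] := @noetherian_chain _ (fun k => sval (F k)) noethV.
  by move=> k x; exact: (proj1 (svalP (step (F k)))).
have [x [xS xN]] := proj2 (svalP (step (F k))).
by apply: xN; apply: (kP k.+1).
Qed.
End Noetherian.

(** * A weak Artin-Rees lemma *)

Section ArtinRees.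
Variable R : comNzRingType.
Implicit Types U V : lmodType R.

Lemma sum_count_mem (T : finType) (w : seq T) : (\sum_i count_mem i w)%N = size w.
Proof.
elim: w => [|j w IH] /=; first by rewrite big1.
rewrite big_split /= IH (bigD1 j) //= eqxx big1 ?addn0 // => i.
by rewrite eq_sym => /negPf ->.
Qed.

Lemma prod_word_count (T : eqType) (e : T -> R) (w : seq T) i :
  exists c : R, \prod_(j <- w) e j = c * e i ^+ count_mem i w.
Proof.
elim: w => [|j w [c IH]] /=; first by exists 1; rewrite big_nil expr0 mulr1.
rewrite big_cons IH; have [->|_] := eqVneq j i.
  by exists c; rewrite add1n exprS mulrCA.
by exists (e j * c); rewrite add0n mulrA.
Qed.

(** If m bounds the sum of the exponents needed for the t generators, a product
    of more than t m of them contains one generator at least m times.  The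
    induction moves factors of an element of the power of a into such a word one
    at a time. *)
Lemma ideal_pow_nilpotent (a J : ideal R) :
  fg_sub a -> (forall x, a x -> exists m, J (x ^+ m : R)) ->
  exists k, forall r, ideal_pow a k r -> J r.
Proof.
move=> [t [e [ae a_gen]]] nil.
have /choice [m mP] (i : 'I_t) : exists m, J ((e i : R) ^+ m : R) by exact: nil.
pose mm := (\sum_i m i)%N.
have J_word (w : seq 'I_t) : (t * mm < size w)%N -> J (\prod_(i <- w) (e i : R) : R).
  move=> w_long.
  have [i wi] : exists i : 'I_t, (mm <= count_mem i w)%N.
    apply: contrapT => short; move: w_long; rewrite ltnNge -(sum_count_mem w); case/negP.
    have -> : (t * mm)%N = (\sum_(i < t) mm)%N by rewrite sum_nat_const card_ord.
    apply: leq_sum => i _.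
    by rewrite leqNgt; apply/negP => /ltnW mi; apply: short; exists i.
  have [c ->] := prod_word_count (fun i => e i : R) w i.
  apply: (submoduleZ (s := J) c).
  have mi : (m i <= count_mem i w)%N.
    by apply: leq_trans wi; rewrite /mm (bigD1 i) //= leq_addr.
  rewrite -(subnK mi) exprD; exact: (submoduleZ (s := J)).
(* The successor keeps the exponent positive when a is generated by no element. *)
exists (t * mm).+1.
suff H k (w : seq 'I_t) r : (size w + k = (t * mm).+1)%N -> ideal_pow a k r ->
    J ((\prod_(i <- w) (e i : R)) * (r : R) : R).
  by move=> r ar; have := H _ [::] r (add0n _) ar; rewrite big_nil mul1r.
elim: k w r => [|k IH] w r sz.
  move=> _; rewrite mulrC; apply: (submoduleZ (s := J)); apply: J_word.
  by rewrite -sz addn0.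
move=> [s sP ->]; rewrite mulr_sumr big_seq_cond.
apply: (big_ind (J : R^o -> Prop)); first exact: submodule0.
  exact: submoduleD.
move=> q /andP[/sP [/a_gen [c ->] pq] _].
rewrite -[_ *: _]/((\sum_i c i *: e i) * q.2) mulrA mulr_sumr mulr_suml.
apply: submodule_sum => i.
have -> : \prod_(j <- w) (e j : R) * (c i *: e i) * q.2 =
          c i * ((\prod_(j <- i :: w) (e j : R)) * (q.2 : R)) :> R.
  by rewrite big_cons -[c i *: e i]/(c i * e i) (mulrC (e i)) -!mulrA mulrCA.
apply: (submoduleZ (s := J)); apply: IH => //.
by rewrite -sz addnS.
Qed.

Lemma ideal_pow_expr (a : ideal R) x j : a x -> ideal_pow a j (x ^+ j : R).
Proof.
move=> ax; elim: j => // j IH; exists [:: (x, x ^+ j : R)].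
  by move=> p; rewrite inE => /eqP ->.
by rewrite big_seq1 exprS.
Qed.

Definition colon_ideal V (N : submodule V) : ideal R.
Proof.
apply: (@Submodule R R^o (fun r => forall p, N ((r : R) *: p))).
- by move=> p; rewrite scale0r; exact: submodule0.
- by move=> r s Jr Js p; rewrite scalerDl; exact: submoduleD.
- by move=> c r Jr p; rewrite -scalerA; exact: submoduleZ.
Defined.

(** Take N maximal among the submodules of V that meet U in a^j U.  For x in a,
    the chain of the (N : x^m) stabilizes, and for large m the submodule
    N + x^m V still meets U in a^j U; by maximality x^m V lies in N.  As a is
    finitely generated, some power of a carries V into N. *)
Lemma artin_rees (a : ideal R) U V (i : {linear U -> V}) j :
  noetherian R -> noetherian_module V -> injective i ->
  exists k, forall y : U, ideal_mul (ideal_pow a k) (full_sub V) (i y) ->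
    ideal_mul (ideal_pow a j) (full_sub U) y.
Proof.
move=> noethR noethV inj_i.
pose aU := ideal_mul (ideal_pow a j) (full_sub U).
pose Phi (N : submodule V) := (forall y, aU y -> N (i y)) /\
  forall y, N (i y) -> aU y.
have [|N [aUN NaU] Nmax] := @noetherian_maximal R V Phi (sub_image i aU) noethV.
  split=> [y aUy|y /sub_imageP [y' aUy' /inj_i <-] //].
  by apply/sub_imageP; exists y.
have nil (x : R) : a x -> exists m, forall p, N (x ^+ m *: p).
  move=> ax; pose sc m : {linear V -> V} := (x ^+ m) \*: idfun.
  have scE m p : sc m p = x ^+ m *: p by [].
  have [|k0 k0P] := noetherian_chain (F := fun m => preimage_sub (sc m) N) noethV.
    move=> m p Np; change (N (sc m.+1 p)); rewrite scE exprS -scalerA.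
    exact: submoduleZ.
  pose m := (k0 + j)%N; exists m.
  have mP m' p : N (x ^+ m' *: p) -> N (x ^+ m *: p).
    move=> /(k0P m') Np; rewrite /m addnC exprD -scalerA; exact: submoduleZ.
  have PhiN' : Phi (sub_add N (image_sub (sc m))).
    split=> [y aUy|y [q [_ [Nq [p <-] iyE]]]].
      exists (i y), 0; split; [exact: aUN | exact: submodule0 | by rewrite addr0].
    have Nxy : N (x ^+ m *: i y).
      apply: (mP j); rewrite -linearZ_LR; apply: aUN.
      exists [:: (x ^+ j : R, y)]; last by rewrite big_seq1.
      by move=> p'; rewrite inE => /eqP ->; split=> //; exact: ideal_pow_expr.
    apply: NaU; rewrite iyE; apply: submoduleD => //; apply: (mP (m + m)%N).
    rewrite exprD -scalerA.
    have -> : x ^+ m *: (x ^+ m *: p) = x ^+ m *: i y - x ^+ m *: q.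
      by rewrite iyE scalerDr addrC addKr.
    by apply: submoduleB => //; exact: submoduleZ.
  move=> p; apply: (Nmax _ PhiN') => [q Nq|].
    by exists q, 0; split; [exact: Nq | exact: submodule0 | rewrite addr0].
  by exists 0, (x ^+ m *: p); split; [exact: submodule0 | exists p | rewrite add0r].
have [k kP] := @ideal_pow_nilpotent a (colon_ideal N) (proj2 (fg_submod a) (noethR a)) nil.
exists k => y [s sP yE]; apply: NaU; rewrite yE big_seq.
apply: (big_ind (N : V -> Prop)); [exact: submodule0 | exact: submoduleD |].
by move=> p /sP [/kP Jp _]; exact: Jp.
Qed.
End ArtinRees.

(** * Generalized local cohomology as a functor *)

Section Limit.
Variable R : comNzRingType.
Variables (a : ideal R) (X : lmodType R).
Implicit Types L M N : lmodType R.

Definition qmap M N (u : {linear M -> N}) (W : submodule M) (W' : submodule N)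
    (uW : forall x, W x -> W' (u x)) : {linear quotmod W -> quotmod W'} :=
  quotmod_map uW.

Lemma qmapE M N (u : {linear M -> N}) (W : submodule M) (W' : submodule N)
    (uW : forall x, W x -> W' (u x)) x : qmap uW (qpi W x) = qpi W' (u x).
Proof. exact: quotmod_mapE. Qed.

Definition pow_sub M k : submodule M := ideal_mul (ideal_pow a k) (full_sub M).

Lemma pow_sub_le M k m : (k <= m)%N -> forall x, pow_sub M m x -> pow_sub M k (idfun x).
Proof.
move=> /subnK <- x; elim: (m - k)%N => //= d IH [s sP xE]; apply: IH.
by exists s => // q /sP [/ideal_powS].
Qed.

Lemma pow_sub_map M N (u : {linear M -> N}) k x :
  pow_sub M k x -> pow_sub N k (u x).
Proof.
move=> [s sP ->]; exists [seq (q.1, u q.2) | q <- s].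
  by move=> _ /mapP [q /sP [aq _] ->].
by rewrite linear_sum big_map; apply: eq_bigr => q _; rewrite linearZ_LR.
Qed.

Lemma pow_sub_surj M N (u : {linear M -> N}) k y :
  (forall y, exists x, u x = y) -> pow_sub N k y ->
  exists2 x, pow_sub M k x & u x = y.
Proof.
move=> /choice [v vK] [s sP ->].
exists (\sum_(q <- s) q.1 *: v q.2); last first.
  by rewrite linear_sum; apply: eq_bigr => q _; rewrite linearZ_LR vK.
exists [seq (q.1, v q.2) | q <- s]; last by rewrite big_map.
by move=> _ /mapP [q /sP [aq _] ->].
Qed.

Definition trunc_proj M k m (km : (k <= m)%N) : {linear trunc a M m -> trunc a M k} :=
  qmap (pow_sub_le (M := M) km).

Definition trunc_fun M N (u : {linear M -> N}) k : {linear trunc a M k -> trunc a N k} :=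
  qmap (@pow_sub_map M N u k).

Lemma trunc_funE M N (u : {linear M -> N}) k x : trunc_fun u k (qpi _ x) = qpi _ (u x).
Proof. exact: qmapE. Qed.

Definition glc_in n M k (w : Ext n (trunc a M k) X) : gen_local_cohomology a n M X :=
  dlim_in (fun k => Ext_map X (trunc_map a M k) n) w.

(** The transition maps of the direct system are induced by the projections
    M/a^m M -> M/a^k M. *)
Lemma push_trunc_proj n M k (w : Ext n (trunc a M k) X) m (km : (k <= m)%N) :
  push (fun k => Ext_map X (trunc_map a M k) n) w m = Ext_map X (trunc_proj M km) n w.
Proof.
elim: m km => [|m IH] km.
  have k0 : k = 0%N by move: km; rewrite leqn0 => /eqP.
  subst k; rewrite push_id -[LHS]Ext_map_id; apply: Ext_map_eq => q.
  by have [x <-] := qpi_surj q; rewrite qmapE.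
have [ek|nk] := eqVneq k m.+1.
  subst k; rewrite push_id -[LHS]Ext_map_id; apply: Ext_map_eq => q.
  by have [x <-] := qpi_surj q; rewrite qmapE.
have km' : (k <= m)%N by rewrite -ltnS ltn_neqAle nk.
rewrite -push_step // (IH km'); apply/esym; apply: Ext_map_comp => q.
have [x <-] := qpi_surj q; rewrite qmapE.
by rewrite [trunc_map]lock /= -lock [trunc_map _ _ _ _]qmapE qmapE.
Qed.

Lemma glc_in_surj n M (z : gen_local_cohomology a n M X) :
  exists k (w : Ext n (trunc a M k) X), glc_in w = z.
Proof. exact: dlim_in_surj. Qed.

Lemma glc_in_trunc_proj n M k m (km : (k <= m)%N) (w : Ext n (trunc a M k) X) :
  glc_in (Ext_map X (trunc_proj M km) n w) = glc_in w.
Proof.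
rewrite -push_trunc_proj; move: (km) => /subnK <-.
elim: (m - k)%N => [|d IH]; first by rewrite add0n push_id.
by rewrite -IH addSn -push_step ?leq_addl // [glc_in _]dlim_in_step.
Qed.

Lemma glc_in_eq0 n M k (w : Ext n (trunc a M k) X) :
  glc_in w = 0 <-> exists m (km : (k <= m)%N), Ext_map X (trunc_proj M km) n w = 0.
Proof.
rewrite /glc_in dlim_in_eq0; split=> [[m km w0]|[m [km w0]]]; exists m.
  by exists km; rewrite -push_trunc_proj.
exact: km.
by rewrite push_trunc_proj.
Qed.

Lemma glc_in_linear n M k (c : R) (w w' : Ext n (trunc a M k) X) :
  glc_in (c *: w + w') = c *: glc_in w + glc_in w'.
Proof.
rewrite /glc_in /dlim_in -linearP; congr (qpi _ _); apply: val_inj.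
apply: functional_extensionality_dep => m.
pose f k := Ext_map X (trunc_map a M k) n.
rewrite -[LHS]/(push f (c *: w + w') m) -[RHS]/(c *: push f w m + push f w' m).
have [km|mk] := leqP k m; first by rewrite !push_trunc_proj linearP.
by rewrite !push_lt // scaler0 addr0.
Qed.

Local Opaque Ext Ext_map gen_local_cohomology glc_in.

Lemma Ext_trunc_fun_proj n M N (u : {linear M -> N}) k m (km : (k <= m)%N)
    (w : Ext n (trunc a N k) X) :
  Ext_map X (trunc_proj M km) n (Ext_map X (trunc_fun u k) n w) =
  Ext_map X (trunc_fun u m) n (Ext_map X (trunc_proj N km) n w).
Proof.
rewrite -(Ext_map_comp (w := trunc_fun u k \o trunc_proj M km)) //.
apply: Ext_map_comp => q; have [x <-] := qpi_surj q.
by rewrite /= -/(trunc_proj M km) -/(trunc_proj N km) !qmapE.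
Qed.

Lemma glc_map_exists n M N (u : {linear M -> N}) :
  exists f : {linear gen_local_cohomology a n N X -> gen_local_cohomology a n M X},
    forall k (w : Ext n (trunc a N k) X),
      f (glc_in w) = glc_in (Ext_map X (trunc_fun u k) n w).
Proof.
pose rel (z : gen_local_cohomology a n N X) (z' : gen_local_cohomology a n M X) :=
  exists k (w : Ext n (trunc a N k) X),
    glc_in w = z /\ glc_in (Ext_map X (trunc_fun u k) n w) = z'.
have raise k m (km : (k <= m)%N) (w : Ext n (trunc a N k) X) :
    glc_in (Ext_map X (trunc_fun u k) n w) =
    glc_in (Ext_map X (trunc_fun u m) n (Ext_map X (trunc_proj N km) n w)).
  by rewrite -Ext_trunc_fun_proj glc_in_trunc_proj.
have rel_lin (c : R) z y z' y' : rel z y -> rel z' y' -> rel (c *: z + z') (c *: y + y').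
  move=> [k [w [<- <-]]] [k' [w' [<- <-]]]; exists (maxn k k').
  rewrite (raise _ _ (leq_maxl k k')) (raise _ _ (leq_maxr k k')).
  rewrite -(glc_in_trunc_proj (leq_maxl k k') w) -(glc_in_trunc_proj (leq_maxr k k') w').
  move: (Ext_map X (trunc_proj N (leq_maxl k k')) n w)
    (Ext_map X (trunc_proj N (leq_maxr k k')) n w') => v v'.
  exists (c *: v + v'); split; first exact: glc_in_linear.
  rewrite -glc_in_linear; congr (glc_in _); exact: linearP.
have rel0 y : rel 0 y -> y = 0.
  move=> [k [w [/glc_in_eq0 [m [km w0]] <-]]].
  rewrite (raise _ _ km) w0 linear0; apply/glc_in_eq0; exists m, (leqnn m); exact: linear0.
have [z|f [_ fP]] := linear_of_relation _ rel_lin rel0.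
  have [k [w <-]] := glc_in_surj z; exists (glc_in (Ext_map X (trunc_fun u k) n w)), k, w.
  by split; exact: erefl.
by exists f => k w; apply: fP; exists k, w; split; exact: erefl.
Qed.

Definition glc_map n M N (u : {linear M -> N}) :
    {linear gen_local_cohomology a n N X -> gen_local_cohomology a n M X} :=
  sval (cid (glc_map_exists n u)).

Lemma glc_map_in n M N (u : {linear M -> N}) k (w : Ext n (trunc a N k) X) :
  glc_map n u (glc_in w) = glc_in (Ext_map X (trunc_fun u k) n w).
Proof. exact: (svalP (cid (glc_map_exists n u))). Qed.

Local Opaque glc_map.

Lemma glc_map_comp n L M N (u : {linear M -> N}) (v : {linear L -> M})
    (w : {linear L -> N}) :
  w =1 u \o v -> forall z, glc_map n w z = glc_map n v (glc_map n u z).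
Proof.
move=> e z; have [k [x <-]] := glc_in_surj z; apply: (etrans (glc_map_in w x)).
apply: (etrans _ (congr1 (glc_map n v) (esym (glc_map_in u x)))).
apply: (etrans _ (esym (glc_map_in v _))); congr (glc_in _).
apply: Ext_map_comp => q; have [y <-] := qpi_surj q.
by rewrite trunc_funE e -[RHS]/(trunc_fun u k (trunc_fun v k (qpi _ y))) !trunc_funE.
Qed.

Lemma glc_map_eq n M N (u v : {linear M -> N}) : u =1 v -> glc_map n u =1 glc_map n v.
Proof.
move=> e z; have [k [x <-]] := glc_in_surj z; rewrite !glc_map_in; congr (glc_in _).
by apply: Ext_map_eq => q; have [y <-] := qpi_surj q; rewrite !trunc_funE e.
Qed.

Lemma glc_map_id n M z : glc_map n (idfun : {linear M -> M}) z = z.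
Proof.
have [k [x <-]] := glc_in_surj z; rewrite glc_map_in; congr (glc_in _).
rewrite -[RHS]Ext_map_id; apply: Ext_map_eq => q.
by have [y <-] := qpi_surj q; rewrite trunc_funE.
Qed.

Lemma glc_map_linear n M N (u v w : {linear M -> N}) (c : R) :
  (forall x, w x = c *: u x + v x) ->
  forall z, glc_map n w z = c *: glc_map n u z + glc_map n v z.
Proof.
move=> e z; have [k [x <-]] := glc_in_surj z; rewrite !glc_map_in -glc_in_linear.
congr (glc_in _).
apply: (Ext_map_linear (u := trunc_fun u k) (v := trunc_fun v k) (c := c)) => q.
have [y <-] := qpi_surj q; rewrite (trunc_funE w) (trunc_funE u) (trunc_funE v) e.
exact: (linearP (qpi (pow_sub N k))).
Qed.
End Limit.

(** * The connecting map of generalized local cohomology *)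

Local Opaque Ext Ext_map gen_local_cohomology glc_in glc_map connects.

Section LimitConnecting.
Variable R : comNzRingType.
Variables (a : ideal R) (X K P M : lmodType R).
Variables (i : {linear K -> P}) (p : {linear P -> M}).
Hypotheses (noethR : noetherian R) (noethP : noetherian_module P).
Hypothesis exact_ip : short_exact i p.
Local Notation H n N := (gen_local_cohomology a n N X).

(** The filtration that P induces on K: it makes K/(K & a^k P) the kernel of
    P/a^k P -> M/a^k M. *)
Definition sub_filt k : submodule K := preimage_sub i (pow_sub a P k).

Lemma sub_filt_le k m : (k <= m)%N -> forall x, sub_filt m x -> sub_filt k (idfun x).
Proof. by move=> km x; exact: (pow_sub_le (M := P) km). Qed.

Definition filt_proj k m (km : (k <= m)%N) :
    {linear quotmod (sub_filt m) -> quotmod (sub_filt k)} := qmap (sub_filt_le km).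

Lemma pow_sub_filt k x : pow_sub a K k x -> sub_filt k (idfun x).
Proof. exact: pow_sub_map. Qed.

Definition trunc_filt k : {linear trunc a K k -> quotmod (sub_filt k)} :=
  qmap (@pow_sub_filt k).

Definition filt_incl k : {linear quotmod (sub_filt k) -> trunc a P k} :=
  qmap (u := i) (W := sub_filt k) (fun x h => h).

Lemma filt_projE k m (km : (k <= m)%N) x :
  filt_proj km (qpi _ x) = qpi (sub_filt k) x.
Proof. exact: qmapE. Qed.

Lemma trunc_filtE k x : trunc_filt k (qpi _ x) = qpi (sub_filt k) x.
Proof. exact: qmapE. Qed.

Lemma filt_inclE k x : filt_incl k (qpi _ x) = qpi _ (i x).
Proof. exact: qmapE. Qed.

Lemma filt_exact k : short_exact (filt_incl k) (trunc_fun a p k).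
Proof.
have [inj_i surj_p exact_p] := exact_ip; split.
- move=> q q'; have [x <-] := qpi_surj q; have [x' <-] := qpi_surj q'.
  rewrite !qmapE => /qpi_eq xx'; apply/qpi_eq.
  by change (pow_sub a P k (i (x - x'))); rewrite linearB.
- move=> y; have [m <-] := qpi_surj y; have [x <-] := surj_p m.
  by exists (qpi _ x); exact: trunc_funE.
- move=> q; have [x <-] := qpi_surj q; rewrite trunc_funE; split.
    rewrite -[0 in X in X -> _](linear0 (qpi _)) => /qpi_eq; rewrite subr0.
    move=> /(pow_sub_surj surj_p) [x' x'k px'].
    have /exact_p [y iy] : p (x - x') = 0 by rewrite linearB px' subrr.
    exists (qpi _ y); rewrite qmapE; apply/qpi_eq; rewrite iy addrAC subrr add0r.
    exact: submoduleN.
  move=> [q' q'E]; have [y yE] := qpi_surj q'; move: q'E; rewrite -yE qmapE.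
  move=> /qpi_eq iyx; rewrite -[RHS](linear0 (qpi _)); apply/qpi_eq; rewrite subr0.
  have -> : p x = p (- (i y - x)).
    by rewrite opprB linearB (proj2 (exact_p (i y))) ?subr0 //; exists y.
  by apply: pow_sub_map; exact: submoduleN.
Qed.

(** By the Artin-Rees lemma the induced filtration is cofinal with the a-adic
    one, so that both define the same direct limit. *)
Lemma filt_cofinal j :
  exists k, (j <= k)%N /\ exists b : {linear quotmod (sub_filt k) -> trunc a K j},
    forall x, b (qpi _ x) = qpi _ x.
Proof.
have [inj_i _ _] := exact_ip.
have [k kP] := artin_rees a j noethR noethP inj_i.
exists (maxn j k); split; first exact: leq_maxl.
have sub x : sub_filt (maxn j k) x -> pow_sub a K j (idfun x).
  by move=> fx; apply: kP; exact: (pow_sub_le (M := P) (leq_maxr j k)).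
by exists (qmap sub) => x; exact: qmapE.
Qed.

(** Classes of the limit for K are represented over the quotients K/(K & a^k P),
    where the connecting maps of Ext live. *)
Definition glc_connects n (z : H n K) (y : H n.+1 M) : Prop :=
  exists k (w : Ext n (quotmod (sub_filt k)) X) (v : Ext n.+1 (trunc a M k) X),
    [/\ connects (filt_incl k) (trunc_fun a p k) w v,
        glc_in (Ext_map X (trunc_filt k) n w) = z & glc_in v = y].

Lemma connects_raise n k m (km : (k <= m)%N) (w : Ext n (quotmod (sub_filt k)) X)
    (v : Ext n.+1 (trunc a M k) X) :
  connects (filt_incl k) (trunc_fun a p k) w v ->
  connects (filt_incl m) (trunc_fun a p m)
    (Ext_map X (filt_proj km) n w) (Ext_map X (trunc_proj a M km) n.+1 v).
Proof.
apply: (connects_natural (be := trunc_proj a P km)) => q.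
  have [x <-] := qpi_surj q.
  rewrite -[LHS]/(filt_incl k (filt_proj km (qpi _ x))).
  by rewrite -[RHS]/(trunc_proj a P km (filt_incl m (qpi _ x))) !qmapE.
have [x <-] := qpi_surj q.
rewrite -[LHS]/(trunc_fun a p k (trunc_proj a P km (qpi _ x))).
by rewrite -[RHS]/(trunc_proj a M km (trunc_fun a p m (qpi _ x))) !qmapE.
Qed.

Lemma trunc_filt_proj n k m (km : (k <= m)%N) (w : Ext n (quotmod (sub_filt k)) X) :
  Ext_map X (trunc_filt m) n (Ext_map X (filt_proj km) n w) =
  Ext_map X (trunc_proj a K km) n (Ext_map X (trunc_filt k) n w).
Proof.
apply: (etrans (esym (Ext_map_comp (w := trunc_filt k \o trunc_proj a K km) _ w))).
  move=> q; have [x <-] := qpi_surj q.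
  rewrite -[LHS]/(trunc_filt k (trunc_proj a K km (qpi _ x))).
  by rewrite -[RHS]/(filt_proj km (trunc_filt m (qpi _ x))) !qmapE.
by apply: Ext_map_comp.
Qed.

Lemma glc_connects_raise n k m (km : (k <= m)%N) (w : Ext n (quotmod (sub_filt k)) X) :
  glc_in (Ext_map X (trunc_filt m) n (Ext_map X (filt_proj km) n w)) =
  glc_in (Ext_map X (trunc_filt k) n w).
Proof.
apply: (etrans (congr1 (@glc_in _ _ _ _ _ _) (trunc_filt_proj km w))).
exact: glc_in_trunc_proj.
Qed.

Lemma glc_connects_total n (z : H n K) : exists y, glc_connects z y.
Proof.
have [j [x <-]] := glc_in_surj z; have [k [jk [b bE]]] := filt_cofinal j.
have [v vP] := connects_total (filt_exact k) (Ext_map X b n x).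
exists (glc_in v), k, (Ext_map X b n x), v; split=> //.
apply: (etrans _ (glc_in_trunc_proj jk x)); congr (glc_in _).
apply/esym/Ext_map_comp => q; have [y <-] := qpi_surj q.
by rewrite -[RHS]/(b (trunc_filt k (qpi _ y))) !qmapE bE.
Qed.

Lemma glc_connects_linear n (c : R) (z : H n K) (y : H n.+1 M) z' y' :
  glc_connects z y -> glc_connects z' y' ->
  glc_connects (c *: z + z') (c *: y + y').
Proof.
move=> [k [w [v [wv <- <-]]]] [k' [w' [v' [wv' <- <-]]]]; exists (maxn k k').
have {}wv := connects_raise (leq_maxl k k') wv.
have {}wv' := connects_raise (leq_maxr k k') wv'.
exists (c *: Ext_map X (filt_proj (leq_maxl k k')) n w +
        Ext_map X (filt_proj (leq_maxr k k')) n w').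
exists (c *: Ext_map X (trunc_proj a M (leq_maxl k k')) n.+1 v +
        Ext_map X (trunc_proj a M (leq_maxr k k')) n.+1 v').
split; first exact: connects_linear.
  rewrite -(glc_connects_raise (leq_maxl k k') w) -(glc_connects_raise (leq_maxr k k') w').
  by apply: (etrans _ (glc_in_linear _ _ _)); congr (glc_in _); exact: linearP.
rewrite -(glc_in_trunc_proj (leq_maxl k k') v) -(glc_in_trunc_proj (leq_maxr k k') v').
exact: glc_in_linear.
Qed.

(** A class w over K/(K & a^k P) that vanishes in the limit for K vanishes over
    some K/a^m K, hence over K/(K & a^l P) for large l. *)
Lemma glc_connects_eq0 n (y : H n.+1 M) : glc_connects (0 : H n K) y -> y = 0.
Proof.
move=> [k [w [v [wv /glc_in_eq0 [m [km w0]] <-]]]].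
have [l [ml [b bE]]] := filt_cofinal m; have kl := leq_trans km ml.
have w0' : Ext_map X (filt_proj kl) n w = 0.
  apply: (etrans _ (linear0 (Ext_map X b n))); rewrite -w0.
  apply: (etrans _ (congr1 (Ext_map X b n) (trunc_filt_proj km w))).
  apply: (etrans (Ext_map_comp (u := filt_proj km) (v := trunc_filt m \o b) _ w)).
    move=> q; have [x <-] := qpi_surj q.
    rewrite -[RHS]/(filt_proj km (trunc_filt m (b (qpi _ x)))).
    by rewrite bE trunc_filtE !filt_projE.
  exact: (Ext_map_comp (u := trunc_filt m) (v := b) (w := trunc_filt m \o b)).
have := connects_raise kl wv; rewrite w0' => /(connects_eq0 (filt_exact l)) v0.
rewrite -(glc_in_trunc_proj kl v) v0; apply/glc_in_eq0.
by exists l, (leqnn l); exact: linear0.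
Qed.

Lemma glc_map_filt n k (w : Ext n (trunc a P k) X) :
  glc_map a X n i (glc_in w) =
  glc_in (Ext_map X (trunc_filt k) n (Ext_map X (filt_incl k) n w)).
Proof.
apply: (etrans (glc_map_in _ _)); congr (glc_in _); apply: Ext_map_comp => q.
have [x <-] := qpi_surj q.
rewrite -[RHS]/(filt_incl k (trunc_filt k (qpi _ x))).
by rewrite trunc_filtE filt_inclE trunc_funE.
Qed.

Lemma glc_connecting n :
  exists delta : {linear H n K -> H n.+1 M},
    (forall z, delta z = 0 <-> exists w, glc_map a X n i w = z) /\
    (forall y, glc_map a X n.+1 p y = 0 <-> exists z, delta z = y).
Proof.
have [delta [dP dE]] := linear_of_relation (@glc_connects_total n)
  (fun c z y z' y' => @glc_connects_linear n c z y z' y') (@glc_connects_eq0 n).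
exists delta; split=> [z|y]; split.
- move=> d0; have := dP z; rewrite d0 => -[k [w [v [wv <-]]]] /glc_in_eq0 [m [km v0]].
  have := connects_raise km wv; rewrite v0 => /(connects_exact_left (filt_exact m)).
  move=> [u uE]; exists (glc_in u); apply: (etrans (glc_map_filt u)).
  by rewrite uE; exact: glc_connects_raise.
- move=> [w <-]; have [k [u <-]] := glc_in_surj w; apply: dE.
  exists k, (Ext_map X (filt_incl k) n u), 0; split.
  + exact: connects_pullback.
  + exact/esym/glc_map_filt.
  + by apply/glc_in_eq0; exists k, (leqnn k); exact: linear0.
- have [k [v <-]] := glc_in_surj y.
  move=> /(etrans (esym (glc_map_in p v)))/glc_in_eq0 [m [km]].
  rewrite Ext_trunc_fun_proj => /(connects_exact_right (filt_exact m)) [w wv].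
  exists (glc_in (Ext_map X (trunc_filt m) n w)); apply: dE.
  exists m, w, (Ext_map X (trunc_proj a M km) n.+1 v); split=> //.
  exact: glc_in_trunc_proj.
- move=> [z <-]; have [k [w [v [/connects_pushforward v0 _ <-]]]] := dP z.
  apply: (etrans (glc_map_in p v)); rewrite v0.
  by apply/glc_in_eq0; exists k, (leqnn k); exact: linear0.
Qed.

Lemma glc_map0_inj z : glc_map a X 0 p z = 0 -> z = 0.
Proof.
have [k [v <-]] := glc_in_surj z.
move=> /(etrans (esym (glc_map_in p v)))/glc_in_eq0 [m [km]].
rewrite Ext_trunc_fun_proj => /Ext_map0_inj v0.
apply/glc_in_eq0; exists m, km; apply: v0 => y.
have [_ surj _] := filt_exact m; exact: surj.
Qed.
End LimitConnecting.

(** * Bounds in a Serre subcategory *)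

Section SerreBounds.
Variables (R : comNzRingType) (S : lmodType R -> Prop).
Variables (T : nmodType) (le : T -> T -> Prop) (lam : lmodType R -> T).
Hypotheses (S_serre : serre S) (T_po : po_monoid le) (lam_sub : subadditive S le lam).
Implicit Types U V W : lmodType R.

(** The theorem bounds lam and asserts membership in S at once, and both pass
    together through subquotients and extensions. *)
Definition bounded U (t : T) : Prop := S U /\ le (lam U) t.

Lemma bounded_le U s t : bounded U s -> le s t -> bounded U t.
Proof. by move=> [SU Us] st; split=> //; exact: po_trans T_po _ _ _ Us st. Qed.

Lemma le_add s s' t t' : le s s' -> le t t' -> le (s + t) (s' + t').
Proof.
move=> ss tt; apply: (po_trans T_po (y := s' + t)); first exact: po_add T_po _ _ _ ss.
by rewrite ![s' + _]addrC; exact: po_add T_po _ _ _ tt.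
Qed.

Lemma le_sum (I : finType) (F G : I -> T) :
  (forall i, le (F i) (G i)) -> le (\sum_i F i) (\sum_i G i).
Proof.
move=> FG; apply: (big_ind2 le) => //; first exact: po_refl T_po _.
by move=> *; exact: le_add.
Qed.

Lemma bounded_extension U V W (f : {linear U -> V}) (g : {linear V -> W}) s t :
  short_exact f g -> bounded U s -> bounded W t -> bounded V (s + t).
Proof.
move=> fg [SU Us] [SW Wt]; have SV : S V by apply/(proj2 S_serre _ _ _ _ _ fg).
split=> //; have [_ _ le_V] := proj2 lam_sub _ _ _ _ _ fg SU SV SW.
exact: po_trans T_po _ _ _ le_V (le_add Us Wt).
Qed.

Lemma short_exact_quotient U V (f : {linear U -> V}) :
  injective f -> short_exact f (qpi (image_sub f)).
Proof.
move=> inj_f; split=> // [y|v]; first exact: qpi_surj.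
by rewrite -[0 in X in X <-> _](linear0 (qpi (image_sub f))) qpi_eq subr0.
Qed.

Lemma short_exact_kernel U V (g : {linear U -> V}) :
  (forall y, exists x, g x = y) -> short_exact (incl (kernel g)) g.
Proof.
move=> surj_g; split=> // [|x]; first exact: val_inj.
split=> [gx|[y <-]]; last by have /smemP := submod_mem y.
by exists (Submod (introT (smemP (kernel g) x) gx)).
Qed.

Lemma bounded_injective U V (f : {linear U -> V}) t :
  injective f -> bounded V t -> bounded U t.
Proof.
move=> /short_exact_quotient fg [SV Vt].
have [SU SW] := proj1 (proj2 S_serre _ _ _ _ _ fg) SV; split=> //.
have [le_U _ _] := proj2 lam_sub _ _ _ _ _ fg SU SV SW.
exact: po_trans T_po _ _ _ le_U Vt.
Qed.

Lemma bounded_surjective U V (g : {linear U -> V}) t :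
  (forall y, exists x, g x = y) -> bounded U t -> bounded V t.
Proof.
move=> /short_exact_kernel fg [SU Ut].
have [SK SV] := proj1 (proj2 S_serre _ _ _ _ _ fg) SU; split=> //.
have [_ le_V _] := proj2 lam_sub _ _ _ _ _ fg SK SU SV.
exact: po_trans T_po _ _ _ le_V Ut.
Qed.

Lemma bounded_zero U : (forall x : U, x = 0) -> bounded U 0.
Proof.
move=> U0; split; last by rewrite (proj1 lam_sub _ U0); exact: po_refl T_po _.
have [[V SV] _] := S_serre.
have inj0 : injective (\0 : {linear U -> V}) by move=> x y _; rewrite (U0 x) (U0 y).
by have [] := proj1 (proj2 S_serre _ _ _ _ _ (short_exact_quotient inj0)) SV.
Qed.

Lemma bounded_kernel U V (f : {linear U -> V}) s t :
  bounded (submod (kernel f)) s -> bounded V t -> bounded U (s + t).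
Proof.
move=> bK bV.
have [|x|g gP] := linear_lift (i := incl (image_sub f)) (g := f).
- exact: val_inj.
- have fx : image_sub f (f x) by exists x.
  by exists (Submod (introT (smemP _ _) fx)).
have surj_g y : exists x, g x = y.
  have /smemP [x fx] := submod_mem y; exists x; apply: val_inj.
  by rewrite [LHS]gP.
have inj_k : injective (incl (kernel g)) by exact: val_inj.
have [x|h hP] := linear_lift (i := incl (kernel f)) (g := incl (kernel g)) val_inj.
  have /smemP gx := submod_mem x.
  have fx : kernel f (val x) by change (f (val x) = 0); rewrite -gP [g _]gx linear0.
  by exists (Submod (introT (smemP _ _) fx)).
apply: bounded_extension (short_exact_kernel surj_g) _ _.
  apply: (bounded_injective (f := h)) bK => x y hxy; apply: inj_k.
  by rewrite -!hP hxy.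
apply: (bounded_injective (f := incl _)) bV; exact: val_inj.
Qed.

(** Two exact rows HP -> HK -> HM -> HP' and EP -> EK -> E1, linked by edge maps,
    the one of P being onto.  An element of ker eM comes from some x in HK, which
    is determined up to the image of HP; so delta' (eK x) in E1 depends on the
    element alone.  If it vanishes, x can be corrected by the image of HP to lie
    in ker eK. *)
Lemma bounded_connecting (HP HK HM HP' EP EK E1 EM : lmodType R)
    (f : {linear HP -> HK}) (delta : {linear HK -> HM}) (g : {linear HM -> HP'})
    (f' : {linear EP -> EK}) (delta' : {linear EK -> E1})
    (eP : {linear HP -> EP}) (eK : {linear HK -> EK}) (eM : {linear HM -> EM}) s t :
  (forall z, delta z = 0 <-> exists w, f w = z) ->
  (forall y, g y = 0 <-> exists z, delta z = y) ->
  (forall z, delta' z = 0 <-> exists w, f' w = z) ->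
  (forall w, eK (f w) = f' (eP w)) -> (forall v, exists w, eP w = v) ->
  (forall y, eM y = 0 -> g y = 0) ->
  bounded (submod (kernel eK)) s -> bounded E1 t ->
  bounded (submod (kernel eM)) (s + t).
Proof.
move=> ker_delta ker_g ker_delta' ef surj_eP ker_eM bK bE.
have [y|c y v y' v'|v|phi [phiP phiE]] := linear_of_relation
    (L := fun (y : submod (kernel eM)) v => exists x, delta x = val y /\ delta' (eK x) = v).
- have /smemP/ker_eM/ker_g [x xy] := submod_mem y.
  by exists (delta' (eK x)), x.
- move=> [x [xy <-]] [x' [xy' <-]]; exists (c *: x + x').
  by rewrite !linearP xy xy'.
- move=> [x [/ker_delta [w <-] <-]]; rewrite ef.
  by apply/ker_delta'; exists (eP w).
apply: (bounded_kernel (f := phi) _ bE).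
(* D collects the admissible x with eK x = 0; delta maps it onto ker phi. *)
pose D := sub_inter (kernel eK) (kernel (eM \o delta)).
have DK (x : submod D) : eK (val x) = 0 /\ eM (delta (val x)) = 0.
  by have /smemP := submod_mem x.
have [x|h hP] := linear_lift (i := incl (kernel eM)) (g := delta \o incl D) val_inj.
  have [_ eMx] := DK x.
  by exists (Submod (introT (smemP (kernel eM) _) eMx)).
have [x|k kP] := linear_lift (i := incl (kernel phi)) (g := h) val_inj.
  have phx : phi (h x) = 0.
    apply: phiE; exists (val x); split; first exact/esym/hP.
    by rewrite (proj1 (DK x)) linear0.
  by exists (Submod (introT (smemP (kernel phi) _) phx)).
apply: (bounded_surjective (g := k)) => [q|].
  have /smemP phq := submod_mem q.
  have [x [xq]] := phiP (val q); rewrite [phi _]phq => /ker_delta' [v vx].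
  have [w wv] := surj_eP v.
  have x'K : eK (x - f w) = 0 by rewrite linearB ef wv vx subrr.
  have dx' : delta (x - f w) = val (val q).
    by rewrite linearB xq (proj2 (ker_delta (f w))) ?subr0 //; exists w.
  have x'D : D (x - f w).
    split=> //; change (eM (delta (x - f w)) = 0); rewrite dx'.
    by have /smemP := submod_mem (val q).
  exists (Submod (introT (smemP D _) x'D)); apply: val_inj; apply: val_inj.
  by rewrite [val (k _)]kP [LHS]hP.
have [x|j jP] := linear_lift (i := incl (kernel eK)) (g := incl D) val_inj.
  by exists (Submod (introT (smemP (kernel eK) _) (proj1 (DK x)))).
apply: (bounded_injective (f := j)) bK => x y jxy; apply: val_inj.
by rewrite -[LHS]jP -[RHS]jP jxy.
Qed.
End SerreBounds.

(** * The edge map *)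

Local Opaque Ext Ext_map gen_local_cohomology glc_map represents.

Section Edge.
Variable R : comNzRingType.
Variables (a : ideal R) (X : lmodType R).
Implicit Types M N : lmodType R.
Local Notation H n N := (gen_local_cohomology a n N X).
Local Notation Y n := (local_cohomology a n X).

Fact scal_linear M (m : M) : linear (fun r : R^o => (r : R) *: m).
Proof. by move=> c r s; rewrite scalerDl scalerA. Qed.

Definition scal M (m : M) : {linear R^o -> M} := linear_pack (scal_linear m).

Lemma scalE M (m : M) (r : R^o) : scal m r = (r : R) *: m. Proof. by []. Qed.

Lemma glc_map0 n M N (z : H n N) : glc_map a X n (\0 : {linear M -> N}) z = 0.
Proof.
have e (x : M) : (\0 : {linear M -> N}) x = 1 *: \0 x + \0 x by rewrite scaler0 addr0.
have := glc_map_linear e z.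
move: (glc_map a X n \0 z) => y /eqP.
by rewrite scale1r -subr_eq0 opprD addNKr oppr_eq0 => /eqP.
Qed.

Lemma glc_map_scale n M (u : {linear M -> M}) (c : R) z :
  (forall x, u x = c *: x) -> glc_map a X n u z = c *: z.
Proof.
move=> e.
have e' x : u x = c *: idfun x + (\0 : {linear M -> M}) x by rewrite e addr0.
rewrite (glc_map_linear e' z) glc_map0 addr0; congr (_ *: _).
exact: glc_map_id.
Qed.

Lemma glc_map_sum n M N (I : Type) (r : seq I) (u : I -> {linear M -> N})
    (w : {linear M -> N}) z :
  (forall x, w x = \sum_(j <- r) u j x) ->
  glc_map a X n w z = \sum_(j <- r) glc_map a X n (u j) z.
Proof.
elim: r w => [|j r IH] w e.
  rewrite big_nil -[RHS](glc_map0 M z); apply: glc_map_eq => x.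
  by rewrite e big_nil.
have lw' : linear (fun x => \sum_(k <- r) u k x).
  move=> c x y; rewrite scaler_sumr -big_split; apply: eq_bigr => k _ /=.
  exact: linearP.
have e' x : w x = 1 *: u j x + linear_pack lw' x by rewrite e big_cons scale1r.
rewrite (glc_map_linear e' z) scale1r big_cons; congr (_ + _).
exact: IH.
Qed.

(** The function m |-> H^n(r |-> r m) z is a linear map from M to the local
    cohomology module; composed with the augmentation it becomes a cocycle for
    Ext^0. *)
Definition edge_cocycle n M (z : H n M) (x : freemod M) : Y n :=
  glc_map a X n (scal (aug M x)) z.

Lemma edge_cocycle_linear n M (z : H n M) : linear (edge_cocycle z).
Proof.
move=> c x y; apply: glc_map_linear => r; rewrite !scalE linearP scalerDr.
by rewrite !scalerA mulrC.
Qed.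

Lemma edge_exists n M :
  exists e : {linear H n M -> Ext 0 M (Y n)},
    forall z, represents (n := 0) (edge_cocycle z) (e z).
Proof.
have [z|c z v z' v'|v|e [eP _]] := linear_of_relation
  (L := fun (z : H n M) (v : Ext 0 M (Y n)) => represents (n := 0) (edge_cocycle z) v).
- apply: (represents_total (n := 0) (h := linear_pack (edge_cocycle_linear z))) => x.
  apply: (etrans _ (glc_map0 _ z)); apply: glc_map_eq => r.
  rewrite scalE; have -> : aug M (bd 0 M x) = 0 by apply/res_exact0; exists x.
  exact: scaler0.
- move=> zv zv'; apply: (represents_linear zv zv') => x; exact: linearP.
- move=> v0; apply/(represents_eq0 v0) => x; exact: linear0.
by exists e.
Qed.

Definition edge n M : {linear H n M -> Ext 0 M (Y n)} := sval (cid (edge_exists n M)).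

Lemma edgeP n M (z : H n M) : represents (n := 0) (edge_cocycle z) (edge n M z).
Proof. exact: (svalP (cid (edge_exists n M))). Qed.

Lemma edge_eq0 n M (z : H n M) :
  edge n M z = 0 <-> forall m, glc_map a X n (scal m) z = 0.
Proof.
split=> [/(represents_eq0 (edgeP z)) z0 m|z0].
  by have := z0 << m >>; rewrite /edge_cocycle augU.
by apply/(represents_eq0 (edgeP z)) => x; exact: z0.
Qed.

Lemma edge_natural n M N (u : {linear M -> N}) (z : H n N) :
  edge n M (glc_map a X n u z) = Ext_map (Y n) u 0 (edge n N z).
Proof.
apply: represents_inj (edgeP _) _.
apply: represents_ext (represents_map u (edgeP z)) _ => x.
rewrite /= /edge_cocycle; apply/esym.
apply: (etrans (esym (glc_map_comp (w := u \o scal (aug M x)) _ z))) => //.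
apply: glc_map_eq => r; rewrite scalE.
have -> : aug N (res_map u 0 x) = u (aug M x) by exact: aug_natural.
exact: linearZ_LR.
Qed.

Section Free.
Variable s : nat.
Local Notation P := 'rV[R]_s.

Fact coord_linear (j : 'I_s) : linear (fun v : P => v 0 j : R^o).
Proof. by move=> c x y; rewrite !mxE. Qed.

Definition coord (j : 'I_s) : {linear P -> R^o} := linear_pack (coord_linear j).

(** The identity of a free module is the sum of the composites of its
    coordinates with its basis vectors. *)
Lemma edge_free_inj n (z : H n P) : edge n P z = 0 -> z = 0.
Proof.
move=> /edge_eq0 z0; rewrite -[LHS]glc_map_id.
apply: (etrans (glc_map_sum (r := index_enum 'I_s)
  (u := fun j => scal (delta_mx 0 j : P) \o coord j) z _)).
  by move=> x; rewrite [LHS]row_sum_delta.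
apply: big1 => j _.
apply: (etrans (glc_map_comp (u := scal (delta_mx 0 j : P)) (v := coord j) (frefl _) z)).
exact: (etrans (congr1 (glc_map a X n (coord j)) (z0 _)) (linear0 _)).
Qed.

Lemma edge_free_surj n (v : Ext 0 P (Y n)) : exists z, edge n P z = v.
Proof.
have [h hv] := represents_surj v.
have [|x x0|h' h'P] := linear_factor (p := aug P) (g := h).
- by move=> x; exists << x >>; exact: augU.
- have /res_exact0 [y <-] := x0; exact: (represents_cocycle hv).
pose z : H n P := \sum_j glc_map a X n (coord j) (h' (delta_mx 0 j)).
exists z; apply: represents_inj (edgeP z) _; apply: (represents_ext hv) => x.
rewrite -h'P /edge_cocycle; move: (aug P x) => m.
rewrite {1}(row_sum_delta m) !linear_sum; apply: eq_bigr => j _.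
rewrite linearZ_LR; apply/esym.
apply: (etrans (esym (glc_map_comp (w := coord j \o scal m) _ _))) => //.
apply: glc_map_scale => r; rewrite /= !mxE mulrC.
by [].
Qed.
End Free.
End Edge.
(** * The induction on the degree *)

Local Opaque edge.

Section Main.
Variable R : comNzRingType.
Variables (a : ideal R) (X : lmodType R).
Implicit Types M N : lmodType R.
Local Notation H n N := (gen_local_cohomology a n N X).
Local Notation Y n := (local_cohomology a n X).

Lemma finite_presentation M : noetherian R -> finitely_generated M ->
  exists (s : nat) (K : lmodType R)
         (i : {linear K -> 'rV[R]_s}) (p : {linear 'rV[R]_s -> M}),
    finitely_generated K /\ short_exact i p.
Proof.
move=> noethR [s [e e_gen]].
have lp : linear (fun v : 'rV[R]_s => \sum_i v 0 i *: e i).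
  move=> c x y; rewrite scaler_sumr -big_split; apply: eq_bigr => i _ /=.
  by rewrite !mxE scalerDl scalerA.
exists s, (submod (kernel (linear_pack lp))), (incl _), (linear_pack lp).
split; first exact/fg_submod/noetherian_rV.
apply: short_exact_kernel => y; have [c ->] := e_gen y.
by exists (\row_i c i); apply: eq_bigr => i _; rewrite mxE.
Qed.

Variables (S : lmodType R -> Prop) (T : nmodType) (le : T -> T -> Prop).
Variable (lam : lmodType R -> T).
Hypotheses (S_serre : serre S) (T_po : po_monoid le) (lam_sub : subadditive S le lam).
Hypothesis noethR : noetherian R.

(** In degree 0 the edge map is injective, since H^0(M) embeds in H^0(P).  In
    degree n+1 the kernel is controlled by the kernel for K in degree n and by
    Ext^1(M, Y_n); the Ext modules of K embed in those of M, one degree higher,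
    because P is projective. *)
Lemma edge_kernel_bounded n M : finitely_generated M ->
  (forall r, (r < n)%N -> S (Ext (n - r) M (Y r))) ->
  bounded S le lam (submod (kernel (edge a X n M)))
    (\sum_(r < n) lam (Ext (n - r) M (Y r))).
Proof.
elim: n M => [|n IH] M fgM Ext_S.
  rewrite big_ord0; apply: (bounded_zero S_serre T_po lam_sub) => z; apply: val_inj.
  have /smemP eMz := submod_mem z.
  have [s [K [i [p [_ ex_p]]]]] := finite_presentation noethR fgM.
  apply: (glc_map0_inj (a := a) ex_p); apply: edge_free_inj.
  apply: (etrans (edge_natural p (val z))).
  exact: (etrans (congr1 (Ext_map (Y 0) p 0) eMz) (linear0 _)).
have [s [K [i [p [fgK ex_p]]]]] := finite_presentation noethR fgM.
have [delta [ker_delta ker_p]] :=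
  glc_connecting a X noethR (noetherian_rV (n := s) noethR) ex_p n.
have [delta' [_ ker_delta' _]] := Ext_connecting (Y n) ex_p 0.
have Ext_K r : (r < n)%N ->
    bounded S le lam (Ext (n - r) K (Y r)) (lam (Ext (n.+1 - r) M (Y r))).
  move=> rn; have := Ext_S r (ltnW rn); rewrite subSn ?(ltnW rn) // => SM.
  have [d [_ ker_d _]] := Ext_connecting (Y r) ex_p (n - r).
  apply: (bounded_injective S_serre T_po lam_sub (f := d)).
    move=> x y dxy; apply/eqP; rewrite -subr_eq0; apply/eqP.
    have /ker_d [w <-] : d (x - y) = 0 by rewrite linearB dxy subrr.
    have -> : w = 0; last exact: linear0.
    move: w; rewrite -(subnSK rn) => w; apply: Ext_projective.
    exact: projective_rV.
  by split=> //; exact: po_refl T_po _.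
rewrite big_ord_recr /= subSnn.
apply: (bounded_connecting S_serre T_po lam_sub ker_delta ker_p ker_delta'
  (eP := edge a X n 'rV[R]_s) (eK := edge a X n K)).
- by move=> w; exact: edge_natural.
- exact: edge_free_surj.
- move=> y ey; apply: edge_free_inj; apply: (etrans (edge_natural p y)).
  exact: (etrans (congr1 (Ext_map _ p 0) ey) (linear0 _)).
- apply: (bounded_le T_po (IH K fgK _)) => [r rn|]; first exact: (proj1 (Ext_K r rn)).
  by apply: (le_sum T_po) => r; exact: (proj2 (Ext_K r (ltn_ord r))).
- by have := Ext_S n (ltnSn n); rewrite subSnn => SE; split=> //; exact: po_refl T_po _.
Qed.

End Main.

Theorem theorem2p6 (R : comNzRingType) (a : ideal R) (S : lmodType R -> Prop)
    (T : nmodType) (le : T -> T -> Prop) (lam : lmodType R -> T)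
    (M X : lmodType R) (n : nat)
    (R_noeth : noetherian R) (S_serre : serre S) (T_po : po_monoid le)
    (lam_sub : subadditive S le lam) (M_fg : finitely_generated M)
    (Ext_S : forall r : nat, (r <= n)%N ->
       S (Ext (n - r) M (local_cohomology a r X))) :
  S (gen_local_cohomology a n M X) /\
  le (lam (gen_local_cohomology a n M X))
     (\sum_(r < n.+1) lam (Ext (n - r) M (local_cohomology a r X))).
Proof.
rewrite big_ord_recr /= subnn.
apply: (bounded_kernel S_serre T_po lam_sub (f := edge a X n M)).
  apply: edge_kernel_bounded => // r rn; apply: Ext_S; exact: ltnW.
by have := Ext_S n (leqnn n); rewrite subnn => SE; split=> //; exact: po_refl T_po _.
Qed.
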